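(* Let $P=\{p_1,\dots,p_n\}$ be a generic set of $n$ points in the plane and let $F$ be a set of pairwise non-crossing edges on $P$ that is independent in the Laman matroid on $K_n$. Then the set of $F$-constrained non-crossing Laman frameworks on $P$ is connected by edge flips: any two such frameworks can be transformed into each other by $O(n^2)$ edge flip operations, each flip deleting one edge and inserting one edge, with every intermediate framework again an $F$-constrained non-crossing Laman framework on $P$.
   Context: Points are identified with labels $1,\dots,n$; an edge $ij$ is the segment $p_ip_j$, and $K_n$ is the set of all such edges. A Laman graph on $\{1,\dots,n\}$ has $2n-3$ edges with every subset of $n'\ge2$ vertices spanning at most $2n'-3$ edges; these are the bases of the Laman (generic rigidity) matroid on $K_n$, whose independent sets are the edge sets in which every $n'\ge2$ vertices span at most $2n'-3$ edges. A Laman framework on $P$ is a Laman graph drawn with vertex $i$ at $p_i$ and straight-segment edges; it is non-crossing if no two segments of non-adjacent edges share a point, and $F$-constrained if it contains $F$. *)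

(* Defs.v *)
From mathcomp Require Import all_boot all_order all_algebra.
From mathcomp Require Import reals.
From mathcomp Require Import mpoly.

Set Implicit Arguments.
Unset Strict Implicit.
Unset Printing Implicit Defensive.

Import Order.TTheory GRing.Theory Num.Theory.
Local Open Scope ring_scope.

(* An edge ij is the two-element set [set i; j]; a graph on {1, ..., n} is a  *)
(* subset of K_n.                                                             *)
Definition Kn (n : nat) : {set {set 'I_n}} := [set e : {set 'I_n} | #|e| == 2%N].

Definition spanned (n : nat) (E : {set {set 'I_n}}) (A : {set 'I_n}) :
  {set {set 'I_n}} := [set e in E | e \subset A].

Definition laman_sparse (n : nat) (E : {set {set 'I_n}}) : Prop :=
  forall A : {set 'I_n}, (2 <= #|A|)%N -> (#|spanned E A| <= 2 * #|A| - 3)%N.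

Definition laman_independent (n : nat) (E : {set {set 'I_n}}) : Prop :=
  E \subset Kn n /\ laman_sparse E.

(* #|E| = 2n - 3 is written additively because subtraction truncates: there   *)
(* is no Laman graph on fewer than two vertices.                              *)
Definition laman_graph (n : nat) (E : {set {set 'I_n}}) : Prop :=
  [/\ E \subset Kn n, (#|E| + 3 = 2 * n)%N & laman_sparse E].

Section Plane.
Variables (R : realType) (n : nat).
Implicit Types (p : 'I_n -> 'rV[R]_2) (E F : {set {set 'I_n}}).

(* The 2n coordinates of the points are algebraically independent over Q.     *)
Definition generic_points p : Prop :=
  forall q : {mpoly rat[n * 2]},
    mmap ratr (fun k => mxvec (\matrix_(i < n) p i) 0 k) q = 0 -> q = 0.

Definition on_segment (a b x : 'rV[R]_2) : Prop :=
  exists2 t : R, 0 <= t <= 1 & x = (1 - t) *: a + t *: b.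

Definition non_crossing p E : Prop :=
  forall i j k l : 'I_n,
    [set i; j] \in E -> [set k; l] \in E ->
    [disjoint [set i; j] & [set k; l]] ->
    ~ exists x, on_segment (p i) (p j) x /\ on_segment (p k) (p l) x.

(* Vertex i is drawn at p i, so a framework on p is given by its edge set.    *)
Definition constrained_nc_laman p F E : Prop :=
  [/\ laman_graph E, non_crossing p E & F \subset E].

End Plane.

Definition edge_flip (n : nat) : rel {set {set 'I_n}} :=
  fun E E' => [exists e in E, exists f in ~: E, E' == f |: (E :\ e)].

(* Main.v *)
(** Extend a framework [L] to a maximal non-crossing edge set [T].  If an edge
    [ua] of [T] is the diagonal of a convex quadrilateral [ubac] made of two empty
    triangles of [T], then the flip [ua -> bc] in [T] costs at most one flip in
    [L]: the edges of [K_4] on [u, a, b, c] other than [ua] cannot all be spanned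
    by [L - ua] in the Laman matroid, for then [ua] would be spanned too.  When two
    frameworks lie in the same [T], basis exchange connects them.

    It remains to make two sets [T], [T'] equal by [O(n^2)] such flips.  Take the
    rightmost point [v] that is the left endpoint of an edge on which they differ,
    say [vw] in [T'] but not in [T].  The edges of [T] crossing [vw] all start to
    the left of [v]; let [u] be the leftmost start, and among the edges [ua]
    crossing [vw] choose the one with [a] farthest from the line [vw].  The two
    triangles of [T] at [ua] have their apexes [b], [c] to the right of [u] and not
    farther than [a] from [vw], so [ua] can be flipped.  A flip replaces an edge by
    one that starts further to the right, and the set of pairs [(v, w)] whose
    segment is crossed by an edge starting to the right of [v] grows strictly;
    there are at most [n^2] such pairs. *)

Require Import Defs.
From mathcomp Require Import mpoly.
From mathcomp Require Import all_boot all_order all_algebra.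
From mathcomp Require Import reals ring lra zify.

Set Implicit Arguments.
Unset Strict Implicit.
Unset Printing Implicit Defensive.

Import Order.TTheory GRing.Theory Num.Theory.

(** * The Laman matroid *)

(* Elaboration leaves [reverse_coercion] markers and unreduced sorts in some
   cardinals, which hides from [lia] that they are the same atom. *)
Ltac clia := unfold reverse_coercion in *; simpl in *; lia.

Section LamanMatroid.
Variable n : nat.
Implicit Types (S G T L : {set {set 'I_n}}) (A B C e f : {set 'I_n}).

Lemma card_Kn e : (e \in Kn n) = (#|e| == 2).
Proof. by rewrite inE. Qed.

(** The rigid blocks of [S]. When [S] is independent, its closure in the Laman matroid consists of
    the edges lying inside some tight set. Adding 3 avoids truncated subtraction. *)
Definition tight S A : bool := (2 <= #|A|) && (#|spanned S A| + 3 == 2 * #|A|).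

Lemma spannedI S A B : spanned S A :&: spanned S B = spanned S (A :&: B).
Proof. by apply/setP => e; rewrite !inE subsetI; case: (e \in S). Qed.

Lemma spanned_supermodular S A B :
  #|spanned S A| + #|spanned S B| <= #|spanned S (A :|: B)| + #|spanned S (A :&: B)|.
Proof.
rewrite -cardsUI spannedI leq_add2r; apply/subset_leq_card/subsetP => e.
rewrite !inE => /orP[]/andP[-> h] /=; apply: subset_trans h _;
  [exact: subsetUl | exact: subsetUr].
Qed.

Lemma laman_sparseS S G : S \subset G -> laman_sparse G -> laman_sparse S.
Proof.
move=> sub spG A A2; apply: leq_trans (spG A A2).
apply/subset_leq_card/subsetP => e; rewrite !inE => /andP[eS ->].
by rewrite (subsetP sub).
Qed.

(** By supermodularity the union and the intersection span at least as many edges in total as [A]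
    and [B], which is the most that sparsity allows; so both bounds are attained. The intersection
    needs two vertices for its bound to apply. *)
Lemma tightU S A B : laman_sparse S -> tight S A -> tight S B ->
  2 <= #|A :&: B| -> tight S (A :|: B).
Proof.
move=> sp /andP[A2 /eqP tA] /andP[B2 /eqP tB] AB2.
have AUB2 : 2 <= #|A :|: B| by apply: leq_trans A2 _; rewrite subset_leq_card ?subsetUl.
have := spanned_supermodular S A B; have := cardsUI A B.
have := sp _ AB2; have := sp _ AUB2.
by rewrite /tight AUB2 /=; clia.
Qed.

Lemma edge_subset (i j : 'I_n) A : ([set i; j] \subset A) = (i \in A) && (j \in A).
Proof. by rewrite subUset !sub1set. Qed.

Lemma tight_edge S e : S \subset Kn n -> laman_sparse S -> e \in S -> tight S e.
Proof.
move=> sub sp eS; have /eqP e2 : #|e| == 2 by rewrite -card_Kn (subsetP sub).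
have e2' : 2 <= #|e| by rewrite e2.
have := sp e e2'; rewrite /tight e2 /=.
have : 0 < #|spanned S e| by apply/card_gt0P; exists e; rewrite inE eS subxx.
clia.
Qed.

(** Adding [e] changes the count only on vertex sets containing [e], and only by one, so a bound
    that becomes violated was attained before. *)
Lemma tight_of_dependent S e : S \subset Kn n -> laman_sparse S -> e \in Kn n ->
  ~ laman_sparse (e |: S) -> exists2 A, tight S A & e \subset A.
Proof.
move=> sub sp eK nsp.
have [/exists_inP[A tA eA]|/exists_inPn h] := boolP [exists A in tight S, e \subset A].
  by exists A.
have eS : e \notin S.
  apply/negP => eS; have := h e; rewrite subxx => /(_ _)/negP; apply => //.
  exact: tight_edge.
case: nsp => A A2; have [eA|neA] := boolP (e \subset A); last first.
  rewrite (_ : spanned (e |: S) A = spanned S A); first exact: sp.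
  by apply/setP => f; rewrite !inE; case: eqP => // ->; rewrite (negPf neA) (negPf eS).
rewrite (_ : spanned (e |: S) A = e |: spanned S A); last first.
  by apply/setP => f; rewrite !inE; case: eqP => // ->; rewrite eA.
rewrite cardsU1 inE (negPf eS) /=.
have := sp A A2; have := h A; rewrite eA => /contraTN/(_ isT).
by rewrite unfold_in /tight A2 /=; clia.
Qed.

(* Three rigid blocks meeting pairwise in one vertex form a rigid triangle. *)
Lemma tight_triangle S (i j k : 'I_n) A B C : S \subset Kn n -> laman_sparse S ->
    i != j -> j != k -> i != k -> tight S A -> tight S B -> tight S C ->
    [set i; j] \subset A -> [set j; k] \subset B -> [set i; k] \subset C ->
  exists2 U, tight S U & [&& i \in U, j \in U & k \in U].
Proof.
rewrite !edge_subset => sub sp ij jk ik tA tB tC /andP[iA jA] /andP[jB kB] /andP[iC kC].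
have [AB|AB] := leqP 2 #|A :&: B|.
  by exists (A :|: B); [exact: tightU | rewrite !inE iA jA kB orbT].
have [BC|BC] := leqP 2 #|B :&: C|.
  by exists (B :|: C); [exact: tightU | rewrite !inE jB kB iC orbT].
have [AC|AC] := leqP 2 #|A :&: C|.
  by exists (A :|: C); [exact: tightU | rewrite !inE iA jA kC orbT].
(* Now two blocks share only a corner, so an edge lies in at most one of them, and [A :|: B] meets
   [C] in two vertices. The union has |A|+|B|+|C|-3 vertices and at least 2(|A|+|B|+|C|)-9 edges,
   which makes it tight. *)
have sub1 (x : 'I_n) (X : {set 'I_n}) : x \in X -> #|X| < 2 -> X = [set x].
  move=> xX X2; apply/esym/eqP; by rewrite eqEcard sub1set xX cards1.
have eAB : A :&: B = [set j] by apply: sub1 => //; rewrite inE jA.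
have eBC : B :&: C = [set k] by apply: sub1 => //; rewrite inE kB.
have eAC : A :&: C = [set i] by apply: sub1 => //; rewrite inE iA.
have eI : (A :|: B) :&: C = [set i; k] by rewrite setIUl eAC eBC.
exists (A :|: B :|: C); last by rewrite !inE iA jA kB !orbT.
have c1 := cardsUI A B; have c2 := cardsUI (A :|: B) C.
rewrite eAB cards1 in c1; rewrite eI cards2 ik in c2.
have small X e (x : 'I_n) : X = [set x] -> e \in spanned S X -> False.
  move=> ->; rewrite inE => /andP[eS] /subset_leq_card; rewrite cards1.
  by have /eqP-> : #|e| == 2 by rewrite -card_Kn (subsetP sub).
have U2 : 2 <= #|A :|: B :|: C|.
  case/andP: tA => A2 _; apply: leq_trans A2 _.
  by rewrite subset_leq_card // -setUA subsetUl.
have := sp _ U2; case/andP: tA => _ tA; case/andP: tB => _ tB; case/andP: tC => _ tC.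
have s4 : #|spanned S A| + #|spanned S B| + #|spanned S C| <= #|spanned S (A :|: B :|: C)|.
  have dAB : [disjoint spanned S A & spanned S B].
    rewrite -setI_eq0 spannedI; apply/eqP/setP => e; rewrite [RHS]inE.
    by apply/negP => /(small _ _ _ eAB).
  have dABC : [disjoint spanned S A :|: spanned S B & spanned S C].
    rewrite -setI_eq0; apply/eqP/setP => e; rewrite setIUl !spannedI in_setU [RHS]inE.
    by apply/negP => /orP[/(small _ _ _ eAC)|/(small _ _ _ eBC)].
  have <- : #|spanned S A :|: spanned S B| = #|spanned S A| + #|spanned S B|.
    by apply/eqP; rewrite (leq_card_setU _ _).
  have <- : #|spanned S A :|: spanned S B :|: spanned S C| =
      #|spanned S A :|: spanned S B| + #|spanned S C|.
    by apply/eqP; rewrite (leq_card_setU _ _).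
  apply/subset_leq_card/subsetP => e; rewrite !inE => /orP[/orP[]|] /andP[-> h] /=.
  - by apply: subset_trans h _; rewrite -setUA subsetUl.
  - by apply: subset_trans h _; rewrite setUAC subsetUr.
  - by apply: subset_trans h _; rewrite subsetUr.
rewrite /tight U2 /=; move: c1 c2 s4 tA tB tC; clear; clia.
Qed.

(** The triangles [ubc] and [abc] give rigid blocks that share the vertices [b] and [c], so their
    union is rigid. *)
Lemma tight_diagonal S (u a b c : 'I_n) : S \subset Kn n -> laman_sparse S ->
    u != b -> a != b -> u != c -> a != c -> b != c ->
    (forall e, e \in [:: [set u; b]; [set a; b]; [set u; c]; [set a; c]; [set b; c]] ->
       exists2 A, tight S A & e \subset A) ->
  exists2 A, tight S A & [set u; a] \subset A.
Proof.
move=> sub sp ub ab uc ac bc span.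
have [|A1 t1 s1] := span [set u; b]; first by rewrite !inE eqxx.
have [|A2 t2 s2] := span [set a; b]; first by rewrite !inE eqxx orbT.
have [|A3 t3 s3] := span [set u; c]; first by rewrite !inE eqxx !orbT.
have [|A4 t4 s4] := span [set a; c]; first by rewrite !inE eqxx !orbT.
have [|A5 t5 s5] := span [set b; c]; first by rewrite !inE eqxx !orbT.
have [U tU /and3P[uU bU cU]] := tight_triangle sub sp ub bc uc t1 t5 t3 s1 s5 s3.
have [V tV /and3P[aV bV cV]] := tight_triangle sub sp ab bc ac t2 t5 t4 s2 s5 s4.
exists (U :|: V); last by rewrite edge_subset !inE uU aV orbT.
apply: tightU => //; rewrite (_ : 2 = #|[set b; c]|); last by rewrite cards2 bc.
by apply: subset_leq_card; rewrite edge_subset !inE bU bV cU cV.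
Qed.

(** Double counting over the maximal tight sets of [S]: each contains at least as many edges of [S]
    as of [G], every edge of [G] lies in at least one of them, and an edge of [S] lies in at most
    one. *)
Lemma sparse_card_le S G : laman_sparse S -> laman_sparse G ->
    (forall g, g \in G -> #|g| = 2 /\ exists2 A, tight S A & g \subset A) ->
    S \subset Kn n -> #|G| <= #|S|.
Proof.
move=> spS spG span sub.
pose M := [set A | maxset (tight S) A].
have inM g : g \in G -> exists2 A, A \in M & g \subset A.
  move=> /span[_ [A tA gA]]; have [B mB AB] := maxset_exists tA.
  by exists B; [rewrite inE | exact: subset_trans AB].
(* Two maximal tight sets containing a common edge have a tight union, hence coincide. *)
have uniqM e A B : #|e| = 2 -> A \in M -> B \in M -> e \subset A -> e \subset B -> A = B.
  rewrite !inE => e2 /maxsetP[tA mA] /maxsetP[tB mB] eA eB.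
  have AB : 2 <= #|A :&: B| by rewrite -e2 subset_leq_card // subsetI eA.
  have tU := tightU spS tA tB AB.
  by rewrite -(mA _ tU (subsetUl _ _)) -[in RHS](mB _ tU (subsetUr _ _)).
have cnt X A : #|spanned X A| = \sum_(e in X) (e \subset A : nat).
  rewrite -sum1_card (eq_bigl (fun e => (e \in X) && (e \subset A))); last first.
    by move=> e; rewrite inE.
  by rewrite big_mkcondr; apply: eq_bigr => e _; case: (e \subset A).
apply: (@leq_trans (\sum_(A in M) #|spanned G A|)).
  under eq_bigr do rewrite cnt.
  rewrite exchange_big -sum1_card /=; apply: leq_sum => g /inM[A AM gA].
  by rewrite (bigD1 A) //= gA.
apply: (@leq_trans (\sum_(A in M) #|spanned S A|)).
  apply: leq_sum => A; rewrite inE => /maxsetp/andP[A2 tA].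
  by have := spG A A2; clia.
under eq_bigr do rewrite cnt.
rewrite exchange_big -[X in _ <= X]sum1_card /=; apply: leq_sum => e eS.
have e2 : #|e| = 2 by apply/eqP; rewrite -card_Kn (subsetP sub).
have [/exists_inP[A AM eA]|/exists_inPn h] := boolP [exists A in M, e \subset A].
  rewrite (bigD1 A) //= big1 ?addn0 ?leq_b1 // => B /andP[BM BA].
  apply/eqP; rewrite eqb0; apply/negP => eB.
  by move/eqP: BA; apply; exact: (uniqM e).
by rewrite big1 // => A /h/negPf->.
Qed.

Lemma laman_addable S e : S \subset Kn n -> laman_sparse S -> e \in Kn n ->
  (exists2 A, tight S A & e \subset A) \/ (e \notin S /\ laman_sparse (e |: S)).
Proof.
move=> sub sp eK.
have [eS|eS] := boolP (e \in S); first by left; exists e => //; exact: tight_edge.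
have [/forallP h|/forallPn[A hA]] :=
    boolP [forall A : {set 'I_n}, (2 <= #|A|) ==> (#|spanned (e |: S) A| <= 2 * #|A| - 3)].
  by right; split=> // A A2; have /implyP := h A; apply.
left; apply: tight_of_dependent => // h; move: hA.
by rewrite negb_imply => /andP[A2]; rewrite h.
Qed.

Lemma laman_replace L e g : laman_graph L -> e \in L -> g \in Kn n ->
  g \notin L :\ e -> laman_sparse (g |: (L :\ e)) -> laman_graph (g |: (L :\ e)).
Proof.
move=> [sub card _] eL gK ng sp; split=> //.
  by rewrite subUset sub1set gK (subset_trans (subsetDl _ _)).
by move: card; rewrite (cardsD1 e L) eL cardsU1 ng; clia.
Qed.

(** If [L :\ e] spanned every edge of [L'], the rank comparison would give |L'| <= |L| - 1. The edge
    [g] may be [e] itself when [e] is in [L']. *)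
Lemma laman_exchange L L' e : laman_graph L -> laman_graph L' -> e \in L ->
  exists2 g, g \in L' & g \notin L :\ e /\ laman_graph (g |: (L :\ e)).
Proof.
move=> lL [sub' card' sp'] eL; have [sub card sp] := lL.
have subS : L :\ e \subset Kn n by rewrite (subset_trans (subsetDl _ _)).
have spS : laman_sparse (L :\ e) by apply: laman_sparseS sp; exact: subsetDl.
have [/exists_inP[g gL' ng]|/exists_inPn h] := boolP
    [exists g in L', ~~ [exists A, tight (L :\ e) A && (g \subset A)]].
  have gK := subsetP sub' g gL'.
  exists g => //; case: (laman_addable subS spS gK) => [[A tA gA]|[ngS sg]].
    by case/existsP: ng; exists A; rewrite tA.
  by split=> //; exact: laman_replace.
have : #|L'| <= #|L :\ e|.
  apply: sparse_card_le => // g gL'; split; first by apply/eqP; rewrite -card_Kn (subsetP sub').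
  have := h g gL'; rewrite negbK => /existsP[A /andP[tA gA]]; by exists A.
by move: card; rewrite (cardsD1 e L) eL; clia.
Qed.

(** If [L] without [ua] spanned all of [T], the five edges would put [u] and [a] in a common tight
    set, and restoring [ua] would break sparsity there. *)
Lemma laman_flip L T (u a b c : 'I_n) : laman_graph L -> T \subset Kn n ->
    [set u; a] \in L -> u != b -> a != b -> u != c -> a != c -> b != c ->
    {subset [:: [set u; b]; [set a; b]; [set u; c]; [set a; c]; [set b; c]] <= T} ->
  exists2 g, g \in T &
    g \notin L :\ [set u; a] /\ laman_graph (g |: (L :\ [set u; a])).
Proof.
move=> lL subT eL ub ab uc ac bc hT; have [sub card sp] := lL.
set e := [set u; a] in eL *.
have subS : L :\ e \subset Kn n by rewrite (subset_trans (subsetDl _ _)).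
have spS : laman_sparse (L :\ e) by apply: laman_sparseS sp; exact: subsetDl.
have [/exists_inP[g gT ng]|/exists_inPn h] := boolP
    [exists g in T, ~~ [exists A, tight (L :\ e) A && (g \subset A)]].
  have gK := subsetP subT g gT.
  exists g => //; case: (laman_addable subS spS gK) => [[A tA gA]|[ngS sg]].
    by case/existsP: ng; exists A; rewrite tA.
  by split=> //; exact: laman_replace.
have [g /hT gT|A /andP[A2 /eqP tA] eA] := tight_diagonal subS spS ub ab uc ac bc.
  have := h g gT; rewrite negbK => /existsP[A /andP[tA gA]]; by exists A.
have : #|spanned L A| = #|spanned (L :\ e) A|.+1.
  rewrite (cardsD1 e) inE eL eA add1n; congr _.+1; apply: eq_card => f.
  by rewrite !inE andbA.
by have := sp A A2; clia.
Qed.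

End LamanMatroid.

(** * Segments and triangles in the plane *)

Local Open Scope ring_scope.

Section PlaneGeometry.
Variable R : realFieldType.
Implicit Types A B C D M P Q : R * R.

(** Twice the signed area of the triangle [ABC], positive when it is oriented counterclockwise;
    affine in each point separately. *)
Definition det A B C : R :=
  (B.1 - A.1) * (C.2 - A.2) - (B.2 - A.2) * (C.1 - A.1).

(** The point with barycentric coordinates 1 - b - c, b, c with respect to [A], [B], [C]. *)
Definition comb A B C (b c : R) : R * R :=
  (A.1 + b * (B.1 - A.1) + c * (C.1 - A.1),
   A.2 + b * (B.2 - A.2) + c * (C.2 - A.2)).

Definition lerp A B (t : R) : R * R :=
  (A.1 + t * (B.1 - A.1), A.2 + t * (B.2 - A.2)).

Definition onseg A B M : Prop := exists2 t : R, 0 <= t <= 1 & M = lerp A B t.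

Definition meets A B C D : Prop := exists M, onseg A B M /\ onseg C D M.

Definition in_triangle A B C Q : Prop :=
  exists b c : R, [/\ 0 <= b, 0 <= c, b + c <= 1 & Q = comb A B C b c].

(** Proper crossing, as a test of orientations; touching at an endpoint does not count. *)
Definition crossb A B C D : bool :=
  (det A B C * det A B D < 0) && (det C D A * det C D B < 0).

Lemma det_rot A B C : det A B C = det B C A.
Proof. rewrite /det; ring. Qed.

Lemma det_swap A B C : det B A C = - det A B C.
Proof. rewrite /det; ring. Qed.

Lemma det_swapr A B C : det A C B = - det A B C.
Proof. rewrite /det; ring. Qed.

Lemma det_lerp A B P Q t :
  det A B (lerp P Q t) = (1 - t) * det A B P + t * det A B Q.
Proof. rewrite /det /lerp /=; ring. Qed.

Lemma det_comb A B P C D b c :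
  det A B (comb P C D b c) =
  (1 - b - c) * det A B P + b * det A B C + c * det A B D.
Proof. rewrite /det /comb /=; ring. Qed.

Lemma detxx A B : det A A B = 0. Proof. rewrite /det; ring. Qed.
Lemma detxyx A B : det A B A = 0. Proof. rewrite /det; ring. Qed.
Lemma detxyy A B : det A B B = 0. Proof. rewrite /det; ring. Qed.

Lemma lerpC A B t : lerp A B t = lerp B A (1 - t).
Proof. rewrite /lerp; congr pair; ring. Qed.

Lemma lerp1 A B : lerp A B 1 = B.
Proof. by case: B => x y; rewrite /lerp /=; congr pair; ring. Qed.

Lemma onsegC A B M : onseg A B M -> onseg B A M.
Proof. by case=> t t01 ->; exists (1 - t); [lra | rewrite lerpC]. Qed.

Lemma onsegL A B : onseg A B A.
Proof. by exists 0; [lra | rewrite /lerp !mul0r !addr0; case: A]. Qed.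

Lemma onsegR A B : onseg A B B.
Proof. exact/onsegC/onsegL. Qed.

Lemma onseg_sub A B P Q M : onseg A B P -> onseg A B Q -> onseg P Q M ->
  onseg A B M.
Proof.
move=> [t t01 ->] [s s01 ->] [r r01 ->]; exists ((1 - r) * t + r * s); first by nra.
by rewrite /lerp /=; congr pair; ring.
Qed.

Lemma onseg_det A B M : onseg A B M -> det A B M = 0.
Proof. by case=> t _ ->; rewrite det_lerp detxyx detxyy; ring. Qed.

Lemma crossb_sym A B C D : crossb A B C D = crossb C D A B.
Proof. by rewrite /crossb andbC. Qed.

Lemma crossbCl A B C D : crossb A B C D = crossb B A C D.
Proof. by rewrite /crossb !(det_swap A B) mulrNN [det C D B * _]mulrC. Qed.

Lemma crossbCr A B C D : crossb A B C D = crossb A B D C.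
Proof. by rewrite crossb_sym crossbCl crossb_sym. Qed.

Lemma ratio_bounds (x y : R) : x * y < 0 -> 0 <= x / (x - y) <= 1.
Proof.
move=> xy; have n : x - y != 0 by apply/eqP; nra.
have e : x / (x - y) * (x - y) = x by rewrite divfK.
move: (x / (x - y)) e => t e; have [h|h] := ltP y x; nra.
Qed.

Lemma crossb_meets A B C D : crossb A B C D -> meets A B C D.
Proof.
(* The crossing point is where the affine function [det C D] vanishes along [AB], and [det A B]
   along [CD]. *)
case/andP=> h1 h2; pose t := det C D A / (det C D A - det C D B).
pose s := det A B C / (det A B C - det A B D).
have n1 : det A B C - det A B D != 0 by apply/eqP; nra.
have n2 : det C D A - det C D B != 0 by apply/eqP; nra.
exists (lerp A B t); split; first by exists t => //; exact: ratio_bounds.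
exists s; first exact: ratio_bounds.
move: n1 n2; rewrite /lerp /t /s /det => n1 n2.
by congr pair; field; rewrite n1 n2.
Qed.

Lemma opp_sign_of_convex (x y s : R) : x != 0 -> y != 0 -> 0 <= s <= 1 ->
  (1 - s) * x + s * y = 0 -> x * y < 0.
Proof. by move=> x0 y0 s01 e; case: (ltrgtP x 0) x0 => //; case: (ltrgtP y 0) y0 => //; nra. Qed.

Lemma meets_crossb A B C D : det A B C != 0 -> det A B D != 0 ->
  det C D A != 0 -> det C D B != 0 -> meets A B C D -> crossb A B C D.
Proof.
move=> n1 n2 n3 n4 [M [AB CD]]; apply/andP; split.
  have := onseg_det AB; case: CD => s s01 ->; rewrite det_lerp.
  exact: opp_sign_of_convex.
have := onseg_det CD; case: AB => s s01 ->; rewrite det_lerp.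
exact: opp_sign_of_convex.
Qed.

Lemma onseg_common A B C M : det A B C != 0 -> onseg A B M -> onseg A C M -> M = A.
Proof.
move=> n [t _ e] [s _ e2].
have : det A B M = 0 by rewrite e det_lerp detxyx detxyy; ring.
rewrite e2 det_lerp detxyx mulr0 add0r => /eqP; rewrite mulf_eq0 (negPf n) orbF.
by move=> /eqP ->; rewrite /lerp !mul0r !addr0; case: A {n e e2}.
Qed.

(** Cramer's rule for barycentric coordinates. *)
Lemma comb_exists A B C Q : det A B C != 0 ->
  Q = comb A B C (det A Q C / det A B C) (det A B Q / det A B C).
Proof.
move=> n; rewrite [LHS]surjective_pairing /comb; move: n; rewrite /det => n.
by congr pair; field.
Qed.

Lemma pasch_half A B C t b c : 0 <= t <= 1 -> 0 < b -> c < 0 ->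
  exists2 M, onseg (lerp A C t) (comb A B C b c) M & onseg A B M \/ onseg B C M.
Proof.
move=> t01 b0 c0; pose l := t / (t - c).
have tc : 0 < t - c by lra.
have ltc : l * (t - c) = t by rewrite /l divfK // gt_eqF.
have l01 : 0 <= l <= 1 by rewrite divr_ge0 ?ler_pdivrMr //; lra.
have [lb|lb] := lerP (l * b) 1.
  exists (lerp A B (l * b)); last by left; exists (l * b) => //; nra.
  exists l => //; rewrite /lerp /comb /=.
  have e : t + l * (c - t) = 0 by lra.
  congr pair; last first.
    rewrite [RHS](_ : _ =
      A.2 + l * b * (B.2 - A.2) + (t + l * (c - t)) * (C.2 - A.2)); last by ring.
    by rewrite e; ring.
  rewrite [RHS](_ : _ = A.1 + l * b * (B.1 - A.1) + (t + l * (c - t)) * (C.1 - A.1)); last by ring.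
  by rewrite e; ring.
(* the point of the segment at which the barycentric coordinate of A vanishes *)
have bct : 0 < b + c - t by nra.
pose k := (1 - t) / (b + c - t).
have ek : k * (b + c - t) = 1 - t by rewrite /k divfK // gt_eqF.
have k0 : 0 <= k by rewrite divr_ge0 //; lra.
have kl : k < l by nra.
have kc : 0 <= t + k * (c - t) by nra.
exists (lerp (lerp A C t) (comb A B C b c) k); first by exists k => //; lra.
right; exists (1 - k * b); first by nra.
have e : 1 - k * b = t + k * (c - t) by lra.
rewrite e /lerp /comb /=.
have e' : k * b = 1 - (t + k * (c - t)) by lra.
congr pair.
  rewrite [LHS](_ : _ = A.1 + k * b * (B.1 - A.1) + (t + k * (c - t)) * (C.1 - A.1)); last by ring.
  by rewrite e'; ring.
rewrite [LHS](_ : _ = A.2 + k * b * (B.2 - A.2) + (t + k * (c - t)) * (C.2 - A.2)); last by ring.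
by rewrite e'; ring.
Qed.

(** A point outside the triangle but on the side of [AC] where [B] is has a negative coordinate at
    [C] or at [A]; the second case is the first with [A] and [C] exchanged. *)
Lemma pasch A B C Y Q : onseg A C Y -> 0 < det A C B * det A C Q ->
  ~ in_triangle A B C Q ->
  exists2 M, onseg Y Q M & onseg A B M \/ onseg B C M.
Proof.
case=> t t01 -> side nQ.
have n : det A B C != 0 by apply/eqP => e; move: side; rewrite det_swapr e oppr0 mul0r ltxx.
have := comb_exists Q n; set b := _ / _; set c := _ / _ => eQ.
have b0 : 0 < b.
  move: side; rewrite eQ det_comb detxyx detxyy mulr0 add0r mulr0 addr0.
  by rewrite mulrCA pmulr_lgt0 // -expr2 exprn_even_gt0 //= det_swapr oppr_eq0.
have [c0|c0] := ltP c 0; first by rewrite eQ; exact: pasch_half.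
have bc : 1 < b + c.
  by rewrite ltNge; apply/negP => bc; apply: nQ; exists b, c; rewrite ltW.
have t01' : 0 <= 1 - t <= 1 by lra.
have c0' : 1 - b - c < 0 by lra.
have [M] := @pasch_half C B A _ _ _ t01' b0 c0'.
have -> : comb C B A b (1 - b - c) = Q by rewrite eQ /comb /=; congr pair; ring.
rewrite -lerpC => h1 [h2|h2]; exists M => //; [right|left]; exact: onsegC.
Qed.

Lemma in_triangle_swap A B C Q : in_triangle A B C Q -> in_triangle A C B Q.
Proof.
case=> b [c [b0 c0 bc ->]]; exists c, b; split => //; first by rewrite addrC.
by rewrite /comb; congr pair; ring.
Qed.

Lemma in_triangle_rot A B C Q : in_triangle A B C Q -> in_triangle B C A Q.
Proof.
case=> b [c [b0 c0 bc ->]]; exists c, (1 - b - c); split; [lra | lra | lra |].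
by rewrite /comb; congr pair; ring.
Qed.

Lemma in_triangle_dec A B C Q : det A B C != 0 ->
  in_triangle A B C Q \/ ~ in_triangle A B C Q.
Proof.
move=> n; set D := det A B C in n.
pose x := det A Q C / D; pose y := det A B Q / D.
have [/and3P[x0 y0 xy]|h] := boolP [&& 0 <= x, 0 <= y & x + y <= 1].
  by left; exists x, y; split=> //; exact: comb_exists.
right=> -[b [c [b0 c0 bc eQ]]]; move/negP: h; apply.
have -> : x = b.
  by apply/(mulIf n); rewrite /x divfK // eQ /D /det /comb /=; ring.
have -> : y = c.
  by apply/(mulIf n); rewrite /y divfK // eQ /D /det /comb /=; ring.
by apply/and3P.
Qed.

Lemma pos_factors (x y : R) : 0 <= x -> 0 < x * y -> 0 < x /\ 0 < y.
Proof.
rewrite le_eqVlt => /orP[/eqP <-|x0]; first by rewrite mul0r ltxx.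
by rewrite pmulr_rgt0.
Qed.

End PlaneGeometry.

(** * Triangulations of points in general position *)

Lemma ex_argmin (R : realFieldType) (I : finType) (P : pred I) (F : I -> R) i0 :
  P i0 -> exists2 i, P i & forall j, P j -> F i <= F j.
Proof. by move=> Pi0; case: (arg_minP F Pi0) => i Pi mi; exists i. Qed.

Section GeneralPosition.
Variables (R : realFieldType) (I : finType) (pt : I -> R * R).
Hypothesis gp : forall i j k, i != j -> i != k -> j != k ->
  det (pt i) (pt j) (pt k) != 0.

Local Notation dt i j k := (det (pt i) (pt j) (pt k)).
Local Notation crs i j k l := (crossb (pt i) (pt j) (pt k) (pt l)).

Lemma crs_neq i j k l : crs i j k l ->
  [/\ i != k, i != l, j != k, j != l & (i != j) && (k != l)].
Proof.
move=> /andP[h1 h2].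
split; last (apply/andP; split); apply/eqP=> e; move: h1 h2;
  by rewrite e ?detxx ?detxyx ?detxyy ?mul0r ?mulr0 ltxx.
Qed.

Lemma meets_crs i j k l : i != k -> i != l -> j != k -> j != l -> i != j -> k != l ->
  meets (pt i) (pt j) (pt k) (pt l) -> crs i j k l.
Proof.
move=> ik il jk jl ij kl; apply: meets_crossb; apply: gp => //; by rewrite eq_sym.
Qed.

(** * What a vertex sees in a maximal non-crossing graph *)

Section Triangulation.
Variable E : rel I.
Hypothesis Esym : symmetric E.
Hypothesis Eirr : irreflexive E.
Hypothesis nc : forall i j k l, E i j -> E k l -> ~~ crs i j k l.
Hypothesis mx : forall i j, i != j -> ~~ E i j -> exists k l, E k l /\ crs i j k l.

Lemma E_neq i j : E i j -> i != j.
Proof. by move=> h; apply/eqP => e; rewrite e Eirr in h. Qed.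

Lemma nc_meets i j k l : E i j -> E k l -> i != k -> i != l -> j != k -> j != l ->
  ~ meets (pt i) (pt j) (pt k) (pt l).
Proof.
move=> Eij Ekl ik il jk jl m; move/negP: (nc Eij Ekl); apply.
by apply: meets_crs => //; exact: E_neq.
Qed.

(** For fixed [i] and [j] the crossing parameter is a function of [kl], so the first crossing can be
    found by minimising over edges. *)
Lemma crs_param i j k l t : crs i j k l ->
  onseg (pt k) (pt l) (lerp (pt i) (pt j) t) ->
  0 < t < 1 /\ t = dt k l i / (dt k l i - dt k l j).
Proof.
case/andP=> _ h /onseg_det; rewrite det_lerp => e; split.
  move: (dt k l i) (dt k l j) h e => x y h e.
  by case: (ltrgtP x 0) h => [x0|x0|->] h; [nra | nra | rewrite mul0r ltxx in h].
have n : dt k l i - dt k l j != 0 by apply/eqP; nra.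
by apply/(mulIf n); rewrite divfK //; lra.
Qed.

Lemma first_crossing u z : u != z -> ~~ E u z ->
  exists p q t, [/\ E p q, crs u z p q, 0 < t < 1,
    onseg (pt p) (pt q) (lerp (pt u) (pt z) t) &
    forall k l s, E k l -> crs u z k l ->
      onseg (pt k) (pt l) (lerp (pt u) (pt z) s) -> t <= s].
Proof.
move=> uz nE; have [k0 [l0 [E0 c0]]] := mx uz nE.
pose F (x : I * I) := dt x.1 x.2 u / (dt x.1 x.2 u - dt x.1 x.2 z).
have [|[p q] /= /andP[Epq cpq] minF] :=
  @ex_argmin _ _ (fun x : I * I => E x.1 x.2 && crs u z x.1 x.2) F (k0, l0).
  by rewrite E0.
have [M [[t _ eM] pqM]] := crossb_meets cpq.
exists p, q, t; rewrite -eM; have [|t01 et] := @crs_param u z p q t cpq; first by rewrite -eM.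
split=> // k l s Ekl ckl /(crs_param ckl)[_ ->].
by rewrite et; apply: (minF (k, l)); rewrite Ekl.
Qed.

(* Let Y be the point where uz first meets an edge pq.  Among the points of the
   triangle uYq off uY, the one whose direction from u is closest to Y is visible
   from u. *)
Lemma visible_in_triangle u z p q t : E p q -> crs u z p q -> 0 < t < 1 ->
    onseg (pt p) (pt q) (lerp (pt u) (pt z) t) ->
    (forall k l s, E k l -> crs u z k l ->
      onseg (pt k) (pt l) (lerp (pt u) (pt z) s) -> t <= s) ->
  exists z', E u z' /\ exists a b, [/\ 0 <= a, 0 < b, a + b <= 1 &
    pt z' = comb (pt u) (lerp (pt u) (pt z) t) (pt q) a b].
Proof.
move=> Epq cpq t01 pqY tmin; set Y := lerp _ _ t in pqY *.
have [up uq zp zq /andP[uz pq]] := crs_neq cpq.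
have detuY w : det (pt u) Y w = t * det (pt u) (pt z) w.
  by rewrite /Y /det /lerp /=; ring.
set D := det (pt u) Y (pt q).
have D0 : D != 0.
  by rewrite /D detuY mulf_neq0 ?gp ?gt_eqF //; lra.
(* Barycentric coordinates with respect to [u], [Y], [q]. The predicate [cand] describes the
   triangle without its side [uY]; the minimised ratio measures the direction from [u], with value 0
   at [Y] and 1 at [q]. *)
pose al w := det (pt u) (pt w) (pt q) / D; pose be w := det (pt u) Y (pt w) / D.
have ecomb w : pt w = comb (pt u) Y (pt q) (al w) (be w) by exact: comb_exists.
pose cand w := [&& 0 <= al w, 0 < be w & al w + be w <= 1].
have cq : cand q.
  by rewrite /cand /al /be detxyy mul0r -/D divff //; apply/and3P; split; lra.
have [z' /and3P[]] := @ex_argmin _ _ cand (fun w => be w / (al w + be w)) q cq.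
set a := al z'; set b := be z' => a0 b0 ab1 rmin.
have ez' : pt z' = comb (pt u) Y (pt q) a b by exact: ecomb.
exists z'; split; last by exists a, b.
apply/negPn/negP => nE.
have uz' : u != z'.
  by apply/eqP => e; move: b0; rewrite /b /be -e detxyx mul0r ltxx.
have side w : det (pt u) (pt z') w = a * det (pt u) Y w + b * det (pt u) (pt q) w.
  by rewrite ez' /det /comb /=; ring.
have sY : det (pt u) (pt z') Y = - (b * D).
  by rewrite side detxyy /D [det _ _ Y]det_swapr; ring.
have sq : det (pt u) (pt z') (pt q) = a * D by rewrite side detxyy /D; ring.
have DD : 0 < D * D by rewrite -expr2 exprn_even_gt0.
(* By symmetry [r] can be the end of the blocking edge on the side of [uz'] where [Y] lies. *)
suff claim r s : E r s -> crs u z' r s ->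
    0 < det (pt u) (pt z') Y * dt u z' r -> False.
  have [r [s [Ers crs_rs]]] := mx uz' nE.
  have h : dt u z' r * dt u z' s < 0 by case/andP: (crs_rs).
  have [pos|neg] := ltP 0 (det (pt u) (pt z') Y * dt u z' r); first exact: (claim r s).
  apply: (claim s r); [by rewrite Esym | by rewrite crossbCr |].
  have n1 : dt u z' r != 0 by apply/eqP => e; rewrite e mul0r ltxx in h.
  have n2 : det (pt u) (pt z') Y != 0 by rewrite sY oppr_eq0 mulf_neq0 // gt_eqF.
  move: (det (pt u) (pt z') Y) (dt u z' r) (dt u z' s) h neg n1 n2 => x y w h neg n1 n2.
  have : x * y != 0 by rewrite mulf_neq0.
  rewrite neq_lt => /orP[xy|]; last by lra.
  by case: (ltrgtP x 0) n2 => // x0 _; nra.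
move=> Ers crs_rs sr.
have [ur us z'r z's /andP[_ rs]] := crs_neq crs_rs.
have ss : det (pt u) (pt z') Y * dt u z' s < 0.
  have : dt u z' r * dt u z' s < 0 by case/andP: (crs_rs).
  by move: (det (pt u) (pt z') Y) (dt u z' r) (dt u z' s) sr => x y w xy yw; nra.
have [X [[l _ eX] rsX]] := crossb_meets crs_rs.
have [l01 _] : 0 < l < 1 /\ l = dt r s u / (dt r s u - dt r s z').
  by apply: crs_param crs_rs _; rewrite -eX.
have ab0 : 0 < a + b by lra.
(* [Y'] is the point where the ray from [u] through [z'] meets [Yq]. *)
pose rho := b / (a + b).
have rhoE : rho * (a + b) = b by rewrite /rho divfK // gt_eqF.
pose Y' := lerp Y (pt q) rho.
have rho01 : 0 < rho <= 1 by nra.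
have [c [ec ea eb]] : exists c, [/\ a + b = c, a = (1 - rho) * c & b = rho * c].
  by exists (a + b); split => //; lra.
have uY'X : onseg (pt u) Y' X.
  exists (l * (a + b)); first by nra.
  rewrite eX ez' /Y' /lerp /comb /=.
  by rewrite ec ea eb; congr pair; ring.
have detuY' w : det (pt u) (pt z') w = (a + b) * det (pt u) Y' w.
  by rewrite side ec ea eb /Y' /det /lerp /=; ring.
have sideY' : 0 < det (pt u) Y' Y * det (pt u) Y' (pt r).
  move: sr; rewrite !detuY'; move: (det (pt u) Y' Y) (det (pt u) Y' (pt r)) => x y h.
  have p0 : 0 < (a + b) * (a + b) by exact: mulr_gt0.
  have : 0 < (a + b) * (a + b) * (x * y) by move: h; lra.
  by rewrite (pmulr_rgt0 _ p0).
(* Inside [uYY'], [r] would be a candidate with a smaller ratio than [z']. It is not on [uY]: by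
   general position it would have to be [z], which lies beyond [Y]. *)
have ntri : ~ in_triangle (pt u) Y Y' (pt r).
  clear c ec ea eb; case=> c [d [c0 d0 cd1 er]].
  have cpos : 0 < c.
    move: sr; rewrite er det_comb detxyx mulr0 add0r.
    have -> : det (pt u) (pt z') Y' = 0 by rewrite detuY' detxyy mulr0.
    rewrite mulr0 addr0 mulrCA => h; rewrite lt_neqAle c0 andbT eq_sym.
    by apply/eqP => e; rewrite e mul0r ltxx in h.
  have alr : al r = c + d * (1 - rho).
    apply/(mulIf D0); rewrite /al divfK // er /Y' /D /det /comb /lerp /=; ring.
  have ber : be r = d * rho.
    apply/(mulIf D0); rewrite /be divfK // er /Y' /D /det /comb /lerp /=; ring.
  have dpos : 0 < d.
    rewrite lt_neqAle d0 andbT eq_sym; apply/eqP => e.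
    have h0 : dt u z r = 0.
      rewrite er e det_comb detxyx /Y det_lerp detxyx detxyy; ring.
    have [ezr|nzr] := eqVneq z r; last by move: (gp uz ur nzr); rewrite h0 eqxx.
    have : dt u q z = c * t * dt u q z.
      by rewrite {1}ezr er e det_comb /Y det_lerp detxyx; ring.
    have : dt u q z != 0 by apply: gp; rewrite // eq_sym.
    move: (dt u q z) => x x0 /eqP; rewrite -{1}[x]mul1r => /eqP/(mulIf x0).
    by nra.
  have : rho <= be r / (al r + be r).
    apply: rmin; rewrite /cand alr ber; apply/and3P; split; nra.
  rewrite alr ber ler_pdivlMr; last by nra.
  by nra.
(* The segment from [X] to [r] leaves the triangle [uYY'] through [uY] or [YY']. *)
have [M XrM hM] := pasch uY'X sideY' ntri.
have rsM : onseg (pt r) (pt s) M by apply: onseg_sub XrM => //; exact: onsegL.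
have Y'pq : onseg (pt p) (pt q) Y'.
  apply: (onseg_sub pqY (onsegR _ _)); exists rho => //; lra.
(* M lies on both rs and pq, so these edges must share an endpoint *)
have case2 : onseg Y Y' M -> False.
  move=> YY'M; have pqM : onseg (pt p) (pt q) M := onseg_sub pqY Y'pq YY'M.
  have Sq : det (pt u) (pt z') Y * dt u z' q <= 0.
    rewrite sY sq; have : 0 <= a * b * (D * D).
      by apply: mulr_ge0; [apply: mulr_ge0; lra | exact: ltW].
    lra.
  have Sp : 0 < det (pt u) (pt z') Y * dt u z' p.
    have SY : 0 < det (pt u) (pt z') Y * det (pt u) (pt z') Y.
      by rewrite -expr2 exprn_even_gt0 //= sY oppr_eq0 mulf_neq0 // gt_eqF.
    case: pqY => k k01 eY; move: SY; rewrite {2}eY det_lerp.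
    move: (det _ _ Y) (dt u z' p) (dt u z' q) Sq => x y w h1 h2.
    have : 0 < (1 - k) * (x * y) by nra.
    have := k01; have [->|] := eqVneq k 1; first lra.
    move=> k1 k01'; rewrite pmulr_rgt0 //; lra.
  (* With respect to the line [uz'], [r] and [p] are strictly on the side of [Y], [s] is strictly on
     the other side, and [q] is not on that of [Y]. So a shared endpoint can only be [r] = [p] or
     [s] = [q]. *)
  have rq : r != q by apply/eqP => e; move: sr; rewrite e; lra.
  have sp : s != p by apply/eqP => e; move: ss; rewrite e; lra.
  have [erp|nrp] := eqVneq r p.
    have [esq|nsq] := eqVneq s q.
      have := onseg_det rsX; rewrite erp esq eX det_lerp.
      have -> : dt p q z' = (1 - a - b) * dt p q u.
        by rewrite ez' det_comb (onseg_det pqY) detxyy; ring.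
      have : dt p q u != 0 by apply: gp; rewrite // eq_sym.
      move: (dt p q u) => x x0 e.
      have : (1 - l * (a + b)) * x = 0 by lra.
      by move/eqP; rewrite mulf_eq0 (negPf x0) orbF => /eqP; nra.
    have eM : M = pt p.
      rewrite erp in rsM; apply: onseg_common rsM pqM.
      by apply: gp => //; rewrite eq_sym.
    have h1 : det (pt u) Y (pt p) * det (pt u) Y (pt q) < 0.
      case: (pqY) => k k01 eY; apply: (@opp_sign_of_convex _ _ _ k) => //.
        by rewrite detuY mulf_neq0 ?gp ?gt_eqF //; lra.
      by rewrite -det_lerp -eY detxyy.
    case: YY'M => m m01; rewrite eM => eM'.
    move: h1; rewrite eM' det_lerp /Y' det_lerp detxyy -/D.
    have : 0 <= m * rho * (D * D) by apply: mulr_ge0; [apply: mulr_ge0; lra | exact: ltW].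
    lra.
  have [esq|nsq] := eqVneq s q; last first.
    apply: (nc_meets Ers Epq) => //; by exists M.
  have eM : M = pt q.
    apply: (@onseg_common _ (pt q) (pt r) (pt p)).
    - by apply: gp; rewrite // eq_sym.
    - by rewrite -esq; exact: onsegC.
    - exact: onsegC.
  have a00 : a = 0.
    case: XrM => m m01; rewrite eM => eM'.
    have : 0 <= det (pt u) (pt z') Y * dt u z' q.
      rewrite eM' det_lerp.
      have -> : det (pt u) (pt z') X = 0.
        by rewrite eX det_lerp detxyx detxyy; ring.
      rewrite mulr0 add0r mulrCA mulr_ge0 //; [lra | exact: ltW].
    rewrite sY sq => h; have : a * (b * (D * D)) <= 0 by lra.
    have : 0 < b * (D * D) by exact: mulr_gt0.
    by move: (b * _) => x x0 h2; nra.
  have [ezq|nzq] := eqVneq z' q; first by rewrite ezq esq eqxx in z's.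
  by move: (gp uz' uq nzq); rewrite sq a00 mul0r eqxx.
(* An exit through [uY] meets [uz] no later than [Y]; since [pq] is the first edge met, the exit is
   at [Y], which is also on [YY']. *)
case: hM => [[k k01 eM]|//].
have eM' : M = lerp (pt u) (pt z) (k * t).
  by rewrite eM /Y /lerp /=; congr pair; ring.
have uzM : onseg (pt u) (pt z) M by exists (k * t) => //; nra.
have notz w w' : E w w' -> w' != u -> onseg (pt w) (pt w') M -> z != w.
  move=> Eww' w'u wM; apply/eqP => ezw.
  have MZ : M = pt z.
    apply: (@onseg_common _ (pt z) (pt u) (pt w')).
    - rewrite det_rot; apply: gp => //; first by rewrite eq_sym.
      by rewrite ezw eq_sym E_neq.
    - exact: onsegC.
    - by rewrite ezw.
  have : dt p u z = k * t * dt p u z.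
    by rewrite -{1}MZ eM' det_lerp detxyy; ring.
  have : dt p u z != 0 by apply: gp; rewrite // eq_sym.
  move: (dt p u z) => x x0 /eqP; rewrite -{1}[x]mul1r => /eqP/(mulIf x0).
  by nra.
have zr : z != r by apply: (notz r s Ers _ rsM); rewrite eq_sym.
have zs : z != s.
  by apply: (notz s r _ _ (onsegC rsM)); [rewrite Esym | rewrite eq_sym].
have c_uz : crs u z r s by apply: meets_crs => //; exists M.
have tk : t <= k * t by apply: (tmin r s) => //; rewrite -eM'.
have k1 : k = 1 by nra.
by apply: case2; rewrite eM k1 lerp1; exact: onsegL.
Qed.

Lemma visible u z : u != z -> ~~ E u z -> exists p q t,
  [/\ E p q, crs u z p q, 0 < t < 1, onseg (pt p) (pt q) (lerp (pt u) (pt z) t) &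
    exists z', E u z' /\ exists a b, [/\ 0 <= a, 0 < b, a + b <= 1 &
      pt z' = comb (pt u) (lerp (pt u) (pt z) t) (pt q) a b]] /\
    exists z', E u z' /\ exists a b, [/\ 0 <= a, 0 < b, a + b <= 1 &
      pt z' = comb (pt u) (lerp (pt u) (pt z) t) (pt p) a b].
Proof.
move=> uz nE; have [p [q [t [Epq cpq t01 pqY tmin]]]] := first_crossing uz nE.
exists p, q, t; split; first by split=> //; exact: (visible_in_triangle Epq).
apply: (@visible_in_triangle u z q p t) => //; first by rewrite Esym.
  by rewrite crossbCr.
exact: onsegC.
Qed.

Lemma visible_side u z a : u != z -> ~~ E u z -> a != u -> a != z ->
  exists p q t, [/\ E p q, crs u z p q, 0 < t < 1,
    onseg (pt p) (pt q) (lerp (pt u) (pt z) t) & 0 < dt u z a * dt u z q] /\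
    exists z', E u z' /\ exists b c, [/\ 0 <= b, 0 < c, b + c <= 1 &
      pt z' = comb (pt u) (lerp (pt u) (pt z) t) (pt q) b c].
Proof.
move=> uz nE au az; have [p [q [t [[Epq cpq t01 pqY hq] hp]]]] := visible uz nE.
have [h1 _] := andP cpq.
have n : dt u z a != 0 by apply: gp; rewrite // eq_sym.
have [s|s] := ltP 0 (dt u z a * dt u z q); first by exists p, q, t.
exists q, p, t; split=> //; split=> //; first by rewrite Esym.
- by rewrite crossbCr.
- exact: onsegC.
have : (dt u z a * dt u z p) * (dt u z a * dt u z q) < 0.
  by rewrite mulrACA pmulr_rlt0 // -expr2 exprn_even_gt0.
by move: (_ * dt u z p) (_ * dt u z q) s => x y s h; nra.
Qed.

(** Up to a positive factor, [dot z] divided by [s * dt c e z] is the cotangent of the unsigned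
    angle at [c] between [e] and [z]; its maximum gives the direction closest to the ray from [c]
    through [e]. *)
Lemma closest_direction (s : R) c e (P : pred I) z0 : P z0 ->
    (forall z, P z -> 0 < s * dt c e z) ->
  exists2 z, P z & forall w, P w -> s * dt c w z <= 0.
Proof.
move=> Pz0 pos.
pose dot z : R := ((pt z).1 - (pt c).1) * ((pt e).1 - (pt c).1) +
  ((pt z).2 - (pt c).2) * ((pt e).2 - (pt c).2).
have [z Pz zmin] := ex_argmin (fun z => - (dot z / (s * dt c e z))) Pz0.
exists z => // w Pw; have := zmin w Pw; rewrite lerN2.
have z0p := pos z Pz; have w0p := pos w Pw.
rewrite ler_pdivrMr // mulrAC ler_pdivlMr // => h.
pose N : R := ((pt e).1 - (pt c).1) ^+ 2 + ((pt e).2 - (pt c).2) ^+ 2.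
have id : s * dt c w z * N = dot w * (s * dt c e z) - dot z * (s * dt c e w).
  by rewrite /dot /N /det; ring.
have N0 : 0 < N.
  rewrite lt_neqAle addr_ge0 ?sqr_ge0 // andbT eq_sym; apply/eqP => e0.
  move/eqP: e0; rewrite paddr_eq0 ?sqr_ge0 // !sqrf_eq0 => /andP[/eqP h1 /eqP h2].
  by move: z0p; rewrite /det h1 h2 !mul0r subr0 mulr0 ltxx.
by rewrite -(pmulr_lle0 _ N0) id; lra.
Qed.

(** * The empty triangle on one side of an edge *)

Section TriangleOnSide.
Variables u a t : I.
Hypothesis Eua : E u a.
Hypothesis Ht : 0 < dt u a t.
Hypothesis Eut : E u t.
(** No neighbour of [u] on the left of [ua] has a direction strictly between those of [a] and
    [t]. *)
Hypothesis tclosest : forall z, E u z -> 0 < dt u a z -> dt u z t <= 0.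

Let inT z := [&& 0 < dt u a z, 0 < dt a t z & 0 < dt t u z].

(** As [uz] points between [a] and [t], it is no edge and has a first obstacle; let [q] be its end
    on the side of [a]. If [q] is [a], the other end is the required [p]. If [q] is on the left of
    [ua], then [u] has a neighbour too close to [ua]. Otherwise the obstacle leaves the triangle
    [uaZ] through the edge [ua], or through [aZ], which [blocked] forbids. *)
Lemma triangle_push z (Z : R * R) k : inT z -> 0 < k <= 1 ->
    pt z = lerp (pt u) Z k ->
    (forall p q M, E p q -> crs u z p q -> p != a -> q != a ->
      onseg (pt p) (pt q) M -> onseg (pt a) Z M ->
      det (pt u) (pt z) M <= 0 -> False) ->
  exists p, [/\ E a p, inT p & 0 < dt a z p].
Proof.
move=> /and3P[Hz atz tuz] k01 ez blocked.
have uzt : 0 < dt u z t by rewrite -[dt u z t]det_rot.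
have uz : u != z by apply/eqP => e; rewrite e detxyx ltxx in Hz.
have ua : u != a := E_neq Eua.
have az : a != z by apply/eqP => e; rewrite e detxyy ltxx in Hz.
have nE : ~~ E u z by apply/negP => h; have := tclosest h Hz; lra.
have au : a != u by rewrite eq_sym.
have [p [q [s [[Epq cpq s01 pqY side] [z' [Euz' [b [c [b0 c0 bc ez']]]]]]]]] :=
  visible_side uz nE au az.
set Y := lerp _ _ s in pqY ez'.
have [up uq zp zq /andP[_ pq]] := crs_neq cpq.
have uza : dt u z a < 0 by rewrite det_swapr oppr_lt0.
have uzq : dt u z q < 0 by rewrite -(nmulr_rgt0 _ uza).
have HY : det (pt u) (pt a) Y = s * dt u a z by rewrite /Y det_lerp detxyx; ring.
have [eqa|nqa] := eqVneq q a.
  rewrite eqa in pqY cpq Epq pq.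
  have := cpq; rewrite /crossb => /andP[_ cpq2].
  case: pqY => l l01 eY.
  have [l1 Hp] : 0 < 1 - l /\ 0 < dt u a p.
    have : 0 < det (pt u) (pt a) Y by rewrite HY; apply: mulr_gt0; lra.
    by rewrite eY det_lerp detxyy mulr0 addr0; apply: pos_factors; lra.
  have azp : 0 < dt a z p.
    have : 0 < det (pt a) (pt z) Y.
      rewrite /Y det_lerp detxyy mulr0 addr0; apply: mulr_gt0; first lra.
      by rewrite -det_rot.
    by rewrite eY det_lerp detxyx mulr0 addr0 pmulr_rgt0.
  have atp : 0 < dt a t p.
    have : 0 < det (pt a) (pt t) Y.
      rewrite /Y det_lerp; apply: addr_gt0; apply: mulr_gt0 => //; try lra.
      by rewrite -det_rot.
    by rewrite eY det_lerp detxyx mulr0 addr0 pmulr_rgt0.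
  exists p; split=> //; first by rewrite Esym.
  rewrite /inT Hp atp /=; rewrite ltNge; apply/negP => tup.
  have tp : p != t by apply/eqP => e; rewrite e detxyy ltxx in atp.
  have tu : t != u by rewrite eq_sym (E_neq Eut).
  have tup' : dt t u p < 0.
    by rewrite lt_neqAle tup andbT; apply: gp => //; rewrite eq_sym.
  suff : crs a p u t by apply/negP; apply: nc => //; rewrite Esym.
  have e1 : dt u t a = - dt u a t by exact: det_swapr.
  have e2 : dt u t p = - dt t u p by exact: det_swap.
  have e3 : dt a p u = dt u a p by rewrite -det_rot.
  have e4 : dt a p t = - dt a t p by exact: det_swapr.
  by rewrite /crossb e1 e2 e3 e4 mulrN oppr_lt0 mulr_gt0 // mulrNN pmulr_rlt0.
have pa : p != a.
  apply/eqP => e; have /andP[h1 _] := cpq.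
  by rewrite e in h1; lra.
exfalso; have [Hq|Hq] := ltP 0 (dt u a q).
  have Hz' : 0 < dt u a z'.
    rewrite ez' det_comb detxyx mulr0 add0r HY; apply: ltr_wpDl; last exact: mulr_gt0.
    by apply: mulr_ge0 => //; apply: mulr_ge0; lra.
  have := tclosest Euz' Hz'.
  (* Around [u] the order is [a], [q], [z], [t], so the neighbour [z'], in the angle between [q] and
     [z], contradicts the choice of [t]. *)
  have uqt : 0 < dt u q t.
    have id : dt u q t * dt u a z = dt u q z * dt u a t + dt u z t * dt u a q.
      by rewrite /det; ring.
    rewrite -(pmulr_lgt0 _ Hz) id; apply: addr_gt0; apply: mulr_gt0 => //.
    by rewrite det_swapr; lra.
  have -> : dt u z' t = b * (s * dt u z t) + c * dt u q t.
    by rewrite ez' /Y /det /comb /lerp /=; ring.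
  have : 0 <= b * (s * dt u z t) by apply: mulr_ge0 => //; apply: mulr_ge0; lra.
  have := mulr_gt0 c0 uqt; lra.
have Hq' : dt u a q < 0.
  by rewrite lt_neqAle Hq andbT; apply: gp => //; rewrite eq_sym.
have uZ w : det (pt u) (pt z) w = k * det (pt u) Z w.
  by rewrite ez /det /lerp /=; ring.
have uZY : onseg (pt u) Z Y.
  exists (s * k); first by nra.
  by rewrite /Y ez /lerp /=; congr pair; ring.
have side' : 0 < det (pt u) Z (pt a) * det (pt u) Z (pt q).
  move: side; rewrite !uZ; move: (det (pt u) Z (pt a)) (det (pt u) Z (pt q)) => x y h.
  have kk : 0 < k * k by apply: mulr_gt0; lra.
  by rewrite -(pmulr_rgt0 _ kk); lra.
have HZ : 0 < det (pt u) (pt a) Z.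
  by move: Hz; rewrite ez det_lerp detxyx mulr0 add0r pmulr_rgt0 //; lra.
have nin : ~ in_triangle (pt u) (pt a) Z (pt q).
  case=> b' [c' [b'0 c'0 _ eq]]; move: Hq'; rewrite eq det_comb detxyx detxyy.
  have := mulr_ge0 c'0 (ltW HZ); lra.
have [M YqM] := pasch uZY side' nin.
have pqM : onseg (pt p) (pt q) M := onseg_sub pqY (onsegR _ _) YqM.
case=> [uaM|aZM].
  by apply: (nc_meets Epq Eua) => //; rewrite 1?eq_sym //; exists M.
apply: (blocked p q M) => //; case: YqM => m m01 ->.
have -> : det (pt u) (pt z) (lerp Y (pt q) m) = m * dt u z q.
  by rewrite det_lerp /Y det_lerp detxyx detxyy; ring.
nra.
Qed.

(** Among the neighbours of [a] inside the triangle, let [w] have the direction closest to [au];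
    [triangle_push] with [Z] equal to [w] finds one still closer. *)
Lemma triangle_no_chord z : inT z -> E a z -> False.
Proof.
move=> Tz Eaz; pose P w := inT w && E a w.
have Pz : P z by rewrite /P Tz.
have [|w /andP[Tw Eaw] closest] := closest_direction (s := -1) (c := a) (e := u) Pz.
  by move=> w /andP[/and3P[h _ _] _]; rewrite det_swap; lra.
have [|||p [Eap Tp]] := @triangle_push w (pt w) 1 Tw.
- lra.
- by rewrite lerp1.
- move=> p q M Epq cpq pa qa pqM awM _.
  have [_ _ wp wq _] := crs_neq cpq.
  by apply: (nc_meets Epq Eaw) => //; rewrite 1?eq_sym //; exists M.
have /closest : P p by rewrite /P Tp.
by rewrite [dt a w p]det_swapr; lra.
Qed.

(** An obstacle on [at] has an end [q] on the side of [u]. If [q] is [u], its other end is closer in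
    direction to [ua] than [t]. If [q] is in the triangle, [a] has a neighbour inside, contrary to
    [triangle_no_chord]. Otherwise the obstacle crosses [ua] or [ut]. *)
Lemma triangle_third_edge : E a t.
Proof.
apply/negPn/negP => nE.
have ua : u != a := E_neq Eua.
have ut : u != t := E_neq Eut.
have at_ : a != t by apply/eqP => e; move: Ht; rewrite e detxyy ltxx.
have [p [q [s [[Epq cpq s01 pqY side] [z' [Eaz' [b [c [b0 c0 bc ez']]]]]]]]] :=
  visible_side at_ nE ua ut.
set Y := lerp _ _ s in pqY ez'.
have [ap aq tp tq /andP[_ pq]] := crs_neq cpq.
have atu : 0 < dt a t u by rewrite -det_rot.
have atq : 0 < dt a t q by rewrite -(pmulr_rgt0 _ atu).
have HY : 0 < det (pt u) (pt a) Y.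
  by rewrite /Y det_lerp detxyy mulr0 add0r; apply: mulr_gt0 => //; lra.
have [equ|nqu] := eqVneq q u.
  rewrite equ in pqY Epq; case: pqY => l l01 eY.
  have [l1 Hp] : 0 < 1 - l /\ 0 < dt u a p.
    by move: HY; rewrite eY det_lerp detxyx mulr0 addr0; apply: pos_factors; lra.
  have Eup : E u p by rewrite Esym.
  have := tclosest Eup Hp.
  have : 0 < det (pt t) (pt u) Y.
    rewrite /Y det_lerp detxyx mulr0 addr0; apply: mulr_gt0; first lra.
    by rewrite det_rot.
  rewrite eY det_lerp detxyy mulr0 addr0 pmulr_rgt0 //.
  by rewrite det_rot; lra.
have pu : p != u.
  by apply/eqP => e; have /andP[h1 _] := cpq; rewrite e in h1; lra.
have aut : dt a u t != 0 by apply: gp; rewrite // eq_sym.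
have [[b' [c' [b'0 c'0 bc' eq]]]|nin] := in_triangle_dec (pt q) aut.
  have Hq : 0 <= dt u a q.
    rewrite eq det_comb detxyx detxyy mulr0 add0r mulr0 add0r; by apply: mulr_ge0 => //; exact: ltW.
  have tuq : 0 < dt t u q.
    have : 0 <= dt t u q.
      rewrite eq det_comb detxyx detxyy !mulr0 !addr0; apply: mulr_ge0; first lra.
      by rewrite det_rot ltW.
    rewrite le_eqVlt => /orP[/eqP e|//].
    have : dt t u q != 0 by apply: gp; rewrite // 1?eq_sym //.
    by rewrite -e eqxx.
  have tuz' : 0 < dt t u z'.
    have tua : 0 < dt t u a by rewrite det_rot.
    rewrite ez' det_comb /Y det_lerp detxyx mulr0 addr0.
    have h1 := mulr_gt0 c0 tuq.
    have h2 : 0 <= b * ((1 - s) * dt t u a).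
      by apply: mulr_ge0 => //; apply: mulr_ge0; lra.
    have h3 : 0 <= (1 - b - c) * dt t u a by apply: mulr_ge0; lra.
    lra.
  have z'u : z' != u by apply/eqP => e; rewrite e detxyy ltxx in tuz'.
  have Hz' : 0 < dt u a z'.
    have : 0 <= dt u a z'.
      rewrite ez' det_comb detxyy mulr0 add0r; apply: addr_ge0; apply: mulr_ge0; lra.
    rewrite le_eqVlt => /orP[/eqP e|//].
    have : dt u a z' != 0 by apply: gp; rewrite ?(E_neq Eaz') // eq_sym.
    by rewrite -e eqxx.
  apply: (@triangle_no_chord z') => //; rewrite /inT Hz' tuz' andbT /=.
  rewrite ez' det_comb /Y det_lerp detxyx detxyy !mulr0 !addr0 mulr0 !add0r.
  exact: mulr_gt0.
have atY : onseg (pt a) (pt t) Y by exists s => //; lra.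
have [M YqM] := pasch atY side nin.
have pqM : onseg (pt p) (pt q) M := onseg_sub pqY (onsegR _ _) YqM.
case=> [auM|utM].
  apply: (nc_meets Epq Eua) => //; rewrite 1?eq_sym //; exists M; split => //.
  exact: onsegC.
by apply: (nc_meets Epq Eut) => //; rewrite 1?eq_sym //; exists M.
Qed.

(** Project [z] from [u] to the point [Z] of [at]. An edge meeting [aZ] avoids crossing [at] only by
    ending at [t] and meeting it there, but [t] is on the other side of [uz]. So [triangle_push]
    gives a neighbour of [a] inside, contrary to [triangle_no_chord]. *)
Lemma triangle_empty z : in_triangle (pt u) (pt a) (pt t) (pt z) ->
  z \in [:: u; a; t].
Proof.
case=> b [c [b0 c0 bc ez]]; apply/negPn/negP.
rewrite !inE !negb_or => /and3P[zu za zt].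
have ua : u != a := E_neq Eua.
have ut : u != t := E_neq Eut.
have Eat := triangle_third_edge.
have at_ : a != t := E_neq Eat.
have pos x : 0 <= x -> x != 0 -> 0 < x :> R by rewrite lt_neqAle eq_sym => -> ->.
have Tz : inT z.
  apply/and3P; split; apply: pos; try by apply: gp; rewrite // eq_sym.
  - rewrite ez det_comb detxyx detxyy; have := mulr_ge0 c0 (ltW Ht); lra.
  - rewrite ez det_comb detxyx detxyy !mulr0 !addr0; apply: mulr_ge0; first lra.
    by rewrite -det_rot ltW.
  - rewrite ez det_comb detxyx detxyy !mulr0 add0r addr0; apply: mulr_ge0 => //.
    by rewrite det_rot ltW.
have bc0 : 0 < b + c.
  have /and3P[Hz _ _] := Tz; move: Hz; rewrite ez det_comb detxyx detxyy.
  move=> h; apply: pos; first lra.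
  apply/eqP => e; have c00 : c = 0 by lra.
  by rewrite c00 in h; lra.
pose Z := lerp (pt a) (pt t) (c / (b + c)).
have atZ : onseg (pt a) (pt t) Z.
  exists (c / (b + c)) => //; rewrite divr_ge0 ?ler_pdivrMr //; lra.
have ezZ : pt z = lerp (pt u) Z (b + c).
  have n : b + c != 0 by rewrite gt_eqF.
  by rewrite ez /Z /lerp /comb /=; congr pair; field.
have [||p [Eap Tp _]] := @triangle_push z Z (b + c) Tz _ ezZ; last exact: triangle_no_chord Tp Eap.
  lra.
move=> p q M Epq cpq pa qa pqM aZM.
have atM : onseg (pt a) (pt t) M := onseg_sub (onsegL _ _) atZ aZM.
have [_ _ zp zq /andP[_ pq]] := crs_neq cpq.
have uzt : 0 < dt u z t by have /and3P[_ _] := Tz; rewrite det_rot.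
have Mt : M <> pt t -> False.
  move=> nM; have pt_ : p = t \/ q = t.
    have [->|npt] := eqVneq p t; first by left.
    have [->|nqt] := eqVneq q t; first by right.
    by exfalso; apply: (nc_meets Epq Eat) => //; exists M.
  apply: nM; case: pt_ => e; rewrite e in pqM pq.
    apply: (onseg_common _ pqM (onsegC atM)).
    by apply: gp; rewrite // eq_sym.
  apply: (onseg_common _ (onsegC pqM) (onsegC atM)).
  by apply: gp; rewrite // eq_sym.
have [->|/eqP//] := eqVneq M (pt t); lra.
Qed.

End TriangleOnSide.

(** If [u] is not joined to [z0], one end of the first obstacle is on the left of [ua], and so is
    the neighbour that [u] has next to it. Among all neighbours on the left, the one closest in
    direction to [ua] is the apex. *)
Lemma triangle_on_side u a z0 : E u a -> 0 < dt u a z0 ->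
  exists b, [/\ 0 < dt u a b, E u b, E a b &
    forall z, in_triangle (pt u) (pt a) (pt b) (pt z) -> z \in [:: u; a; b]].
Proof.
move=> Eua Hz0.
have [z Eu] : exists z, E u z && (0 < dt u a z).
  have [E0|nE] := boolP (E u z0); first by exists z0; rewrite E0.
  have uz : u != z0 by apply/eqP => e; rewrite e detxyx ltxx in Hz0.
  have [p [q [t [[Epq cpq t01 pqY hq] hp]]]] := visible uz nE.
  have HY : 0 < det (pt u) (pt a) (lerp (pt u) (pt z0) t).
    by rewrite det_lerp detxyx mulr0 add0r; apply: mulr_gt0; lra.
  have [Hq|Hq] := ltP 0 (dt u a q).
    have [z' [Ez' [b [c [b0 c0 bc ez']]]]] := hq; exists z'; rewrite Ez' ez' det_comb.
    rewrite detxyx mulr0 add0r; apply: ltr_wpDl; last exact: mulr_gt0.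
    by apply: mulr_ge0 => //; exact: ltW.
  have Hp : 0 < dt u a p.
    case: pqY => k k01 eY; rewrite eY det_lerp in HY; nra.
  have [z' [Ez' [b [c [b0 c0 bc ez']]]]] := hp; exists z'; rewrite Ez' ez' det_comb.
  rewrite detxyx mulr0 add0r; apply: ltr_wpDl; last exact: mulr_gt0.
  by apply: mulr_ge0 => //; exact: ltW.
have [|t /andP[Eut Ht] closest] := @closest_direction 1 u a (fun w => E u w && (0 < dt u a w)) z Eu.
  by move=> w /andP[_]; rewrite mul1r.
have tcl w : E u w -> 0 < dt u a w -> dt u w t <= 0.
  by move=> Ew Hw; have := closest w; rewrite mul1r Ew Hw; apply.
exists t; split=> //; first exact: triangle_third_edge tcl.
by move=> w; exact: triangle_empty tcl w.
Qed.

(** * Empty triangles and the quadrilateral around a flipped edge *)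

Definition empty_triangle i j k :=
  forall z, in_triangle (pt i) (pt j) (pt k) (pt z) -> z \in [:: i; j; k].

(** As [v] is outside the triangle, the part of [vw] from its crossing with [ua] to [v] leaves
    through one of the other two sides. *)
Lemma exit_triangle v w u a b : crs v w u a -> 0 < dt u a b * dt u a v ->
    v != b -> empty_triangle u a b -> crs v w u b || crs v w a b.
Proof.
move=> cr side vb emp; have [vu va wu wa /andP[vw ua]] := crs_neq cr.
have ub : u != b by apply/eqP => e; rewrite e detxyx mul0r ltxx in side.
have ab : a != b by apply/eqP => e; rewrite e detxyy mul0r ltxx in side.
have wb : w != b.
  apply/eqP => e; case/andP: cr => _; rewrite e => h; lra.
have [M [vwM uaM]] := crossb_meets cr.
have nin : ~ in_triangle (pt u) (pt b) (pt a) (pt v).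
  by move=> /in_triangle_swap/emp; rewrite !inE (negPf vu) (negPf va) (negPf vb).
have [N MvN hN] := pasch uaM side nin.
have vwN : onseg (pt v) (pt w) N := onseg_sub vwM (onsegL _ _) MvN.
case: hN => hN; apply/orP; [left|right]; apply: meets_crs => //; exists N => //.
by split=> //; exact: onsegC.
Qed.

Lemma triangle_beside u a x : E u a -> dt u a x != 0 ->
  exists b, [/\ 0 < dt u a b * dt u a x, E u b, E a b & empty_triangle u a b].
Proof.
move=> Eua; rewrite neq_lt => /orP[neg|pos].
  have Eau : E a u by rewrite Esym.
  have [|b [h Eab Eub emp]] := @triangle_on_side a u x Eau.
    by rewrite det_swap oppr_gt0.
  exists b; split=> //; first by move: h; rewrite det_swap; nra.
  by move=> z /in_triangle_rot/in_triangle_swap/emp; rewrite !inE orbCA.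
have [b [h Eub Eab emp]] := triangle_on_side Eua pos.
by exists b; split=> //; exact: mulr_gt0.
Qed.

(** The diagonal [ua] divides the triangle [bcu]. If the diagonals meet at position s on [ua] and r
    on [bc], then [a] has coordinates (1 - r)/s at [b] and r/s at [c], and comparing x (1 - r) with
    (1 - x - y) r decides on which side of [ua] the point [z] lies. *)
Lemma quad_triangle u a b c z : crs u a b c ->
  in_triangle (pt b) (pt c) (pt u) (pt z) ->
  in_triangle (pt u) (pt a) (pt b) (pt z) \/ in_triangle (pt u) (pt a) (pt c) (pt z).
Proof.
move=> cr [x [y [x0 y0 xy ez]]].
have [M [uaM bcM]] := crossb_meets cr.
have [s _ eM] := uaM; have [r _ eM'] := bcM.
have [s01 _] : 0 < s < 1 /\ s = dt b c u / (dt b c u - dt b c a).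
  by apply: crs_param cr _; rewrite -eM.
have [r01 _] : 0 < r < 1 /\ r = dt u a b / (dt u a b - dt u a c).
  by rewrite crossb_sym in cr; apply: crs_param cr _; rewrite -eM'.
have s0 : s != 0 by rewrite gt_eqF //; lra.
have r0 : r != 0 by rewrite gt_eqF //; lra.
have r1 : 1 - r != 0 by rewrite gt_eqF //; lra.
have ea1 : (pt a).1 = (pt u).1 + ((1 - r) * ((pt b).1 - (pt u).1) + r * ((pt c).1 - (pt u).1)) / s.
  have : M.1 = M.1 by []; rewrite {1}eM eM' /lerp /= => e.
  by apply: (mulIf s0); rewrite mulrDl divfK //; lra.
have ea2 : (pt a).2 = (pt u).2 + ((1 - r) * ((pt b).2 - (pt u).2) + r * ((pt c).2 - (pt u).2)) / s.
  have : M.2 = M.2 by []; rewrite {1}eM eM' /lerp /= => e.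
  by apply: (mulIf s0); rewrite mulrDl divfK //; lra.
have ez' : pt z = comb (pt u) (pt b) (pt c) (1 - x - y) x.
  by rewrite ez /comb; congr pair; ring.
have [h|h] := lerP (x * (1 - r)) ((1 - x - y) * r).
  left; exists (x * s / r), (1 - x - y - x * (1 - r) / r).
  have e1 : x * (1 - r) / r <= 1 - x - y by rewrite ler_pdivrMr //; lra.
  split.
  - apply: divr_ge0; last lra; apply: mulr_ge0 => //; lra.
  - by rewrite subr_ge0.
  - suff : x * s / r <= x + x * (1 - r) / r by lra.
    have -> : x + x * (1 - r) / r = x / r by field.
    by rewrite ler_pM2r ?invr_gt0; [nra | lra].
  - rewrite ez' /comb ea1 ea2; congr pair; field; exact/andP.
right; exists ((1 - x - y) * s / (1 - r)), (x - (1 - x - y) * r / (1 - r)).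
have e1 : (1 - x - y) * r / (1 - r) <= x by rewrite ler_pdivrMr; lra.
have w0 : 0 <= 1 - x - y by lra.
split.
- apply: divr_ge0; last lra; apply: mulr_ge0 => //; lra.
- by rewrite subr_ge0.
- suff : (1 - x - y) * s / (1 - r) <= 1 - x - y + (1 - x - y) * r / (1 - r) by lra.
  have -> : 1 - x - y + (1 - x - y) * r / (1 - r) = (1 - x - y) / (1 - r) by field.
  by rewrite ler_pM2r ?invr_gt0; [nra | lra].
- rewrite ez' /comb ea1 ea2; congr pair; field; exact/andP.
Qed.

Lemma empty_triangle_swap i j k : empty_triangle i j k -> empty_triangle j i k.
Proof.
by move=> emp z /in_triangle_rot/in_triangle_swap/emp; rewrite !inE orbCA.
Qed.

Lemma empty_flip u a b c : crs u a b c -> empty_triangle u a b ->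
  empty_triangle u a c -> empty_triangle b c u.
Proof.
move=> cr emp_b emp_c z hz.
have na : z != a.
  apply/eqP => e; move: hz; rewrite e => -[x [y [x0 y0 xy ez]]].
  case/andP: cr => _; rewrite ez det_comb detxyx detxyy !mulr0 !add0r mulrCA.
  by rewrite ltNge mulr_ge0 // -expr2 sqr_ge0.
case: (quad_triangle cr hz) => [/emp_b|/emp_c]; rewrite !inE (negPf na) /=.
  by case/orP=> ->; rewrite ?orbT.
by case/orP=> ->; rewrite ?orbT.
Qed.

Section Flip.
Variables u a b c : I.
Hypothesis cr : crs u a b c.
Hypothesis Eub : E u b.
Hypothesis Eab : E a b.
Hypothesis Euc : E u c.
Hypothesis Eac : E a c.
Hypothesis emp_b : empty_triangle u a b.
Hypothesis emp_c : empty_triangle u a c.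

(** The point [v] is on the side of [b] or of [c], and [vw] leaves the triangle on that side on its
    way to [v]. *)
Lemma flip_crossing v w : crs v w u a -> v != b -> v != c ->
  [|| crs v w u b, crs v w a b, crs v w u c | crs v w a c].
Proof.
move=> cvw vb vc; have [h1 h2] := andP cr; have [vu va _ _ _] := crs_neq cvw.
have [_ _ _ _ /andP[ua _]] := crs_neq cr.
have n : dt u a v != 0 by apply: gp; rewrite // eq_sym.
have [s|s] := ltP 0 (dt u a b * dt u a v).
  by rewrite !orbA (exit_triangle cvw s vb emp_b).
have s' : 0 < dt u a c * dt u a v.
  have : (dt u a b * dt u a v) * (dt u a c * dt u a v) < 0.
    by rewrite mulrACA nmulr_rlt0 // -expr2 exprn_even_gt0.
  by move: (dt u a b * dt u a v) (dt u a c * dt u a v) s => x y s h; nra.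
by have /orP[->|->] := exit_triangle cvw s' vc emp_c; rewrite !orbT.
Qed.

(** The triangles [bcu] and [bca] are empty too. An edge crossing [bc] leaves [bcu] through the edge
    [bu] or [cu] unless it ends at [u], and likewise for [bca] and [a]. *)
Lemma flip_noncrossing k l : E k l -> crs b c k l ->
  (k = u /\ l = a) \/ (k = a /\ l = u).
Proof.
have emp_u : empty_triangle b c u by exact: empty_flip cr emp_b emp_c.
have emp_a : empty_triangle b c a.
  apply: (@empty_flip a u); first by rewrite crossbCl.
    exact: empty_triangle_swap.
  exact: empty_triangle_swap.
have [_ h] := andP cr.
have Ebu : E b u by rewrite Esym.
have Ecu : E c u by rewrite Esym.
have Eba : E b a by rewrite Esym.
have Eca : E c a by rewrite Esym.
suff claim k' l' : E k' l' -> crs b c k' l' -> 0 < dt b c u * dt b c k' ->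
    k' = u /\ l' = a.
  move=> Ekl ckl; have [s|s] := ltP 0 (dt b c u * dt b c k).
    by left; exact: claim.
  right; apply/and_comm; apply: claim; [by rewrite Esym | by rewrite crossbCr |].
  have /andP[h1 _] := ckl.
  have n : dt b c u != 0 by apply/eqP => e; rewrite e mul0r ltxx in h.
  have : (dt b c u * dt b c k) * (dt b c u * dt b c l) < 0.
    by rewrite mulrACA pmulr_rlt0 // -expr2 exprn_even_gt0.
  by move: (dt b c u * dt b c k) (dt b c u * dt b c l) s => x y s h2; nra.
move=> Ekl ckl s; have ckl' : crs k' l' b c by rewrite crossb_sym.
have clk' : crs l' k' b c by rewrite crossbCl.
have Elk : E l' k' by rewrite Esym.
split; apply/eqP/negPn/negP => ne.
  case/orP: (exit_triangle ckl' s ne emp_u) => hc.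
    by move: (nc Ekl Ebu); rewrite hc.
  by move: (nc Ekl Ecu); rewrite hc.
have s' : 0 < dt b c a * dt b c l'.
  have /andP[h1 _] := ckl.
  move: (dt b c u) (dt b c a) (dt b c k') (dt b c l') h s h1 => x y z w xy xz zw.
  have : 0 < (x * y) * (z * w) by rewrite nmulr_rgt0.
  by rewrite mulrACA pmulr_rgt0.
case/orP: (exit_triangle clk' s' ne emp_a) => hc.
  by move: (nc Elk Eba); rewrite hc.
by move: (nc Elk Eca); rewrite hc.
Qed.

End Flip.

(** * Choice of the edge to flip *)

Hypothesis Xinj : forall i j, i != j -> (pt i).1 != (pt j).1.

Lemma flippable_edge v w : v != w -> ~~ E v w ->
    (forall k l, E k l -> crs v w k l ->
      ((pt k).1 < (pt v).1 /\ (pt k).1 < (pt w).1) \/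
      ((pt l).1 < (pt v).1 /\ (pt l).1 < (pt w).1)) ->
  exists u a b c, [/\ E u a, crs v w u a, crs u a b c,
    [/\ E u b, E a b, E u c & E a c] &
    [/\ (pt u).1 < (pt a).1, (pt u).1 < (pt b).1, (pt u).1 < (pt c).1,
      empty_triangle u a b & empty_triangle u a c]].
Proof.
move=> vw nE left_of.
have [k0 [l0 [E0 c0]]] := mx vw nE.
pose P (x : I * I) := E x.1 x.2 && crs v w x.1 x.2.
have P0 : P (k0, l0) by rewrite /P E0.
have [[u a0] /= Pua0 umin] := ex_argmin (fun x : I * I => (pt x.1).1) P0.
have uleft k l : E k l -> crs v w k l -> (pt u).1 <= (pt k).1 /\ (pt u).1 <= (pt l).1.
  move=> Ekl ckl; split; first by apply: (umin (k, l)); rewrite /P Ekl.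
  by apply: (umin (l, k)); rewrite /P /= Esym Ekl crossbCr.
have ltX k : k != u -> (pt u).1 <= (pt k).1 -> (pt u).1 < (pt k).1.
  by move=> ku; rewrite le_eqVlt eq_sym (negPf (Xinj ku)).
(* A positive multiple of the distance from the line [vw], signed so as to be negative at [u]. *)
pose h i := - dt v w u * dt v w i.
have [a /andP[Eua cua] amax] := ex_argmin (fun a => - h a) (P := fun a => P (u, a)) Pua0.
rewrite /= in Eua cua.
have [vu va wu wa /andP[_ ua]] := crs_neq cua.
have au : a != u by rewrite eq_sym.
have Xa : (pt u).1 < (pt a).1 by apply: ltX => //; have [] := uleft _ _ Eua cua.
have [Xv Xw] : (pt u).1 < (pt v).1 /\ (pt u).1 < (pt w).1.
  by have [|] := left_of _ _ Eua cua; lra.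
have [cua1 cua2] := andP cua.
have hu : h u < 0.
  rewrite /h mulNr oppr_lt0 -expr2 exprn_even_gt0 //=.
  by apply/eqP => e; rewrite e mul0r ltxx in cua1.
have ha : 0 < h a by rewrite /h mulNr oppr_gt0.
(* The apex [b] is an end of [vw], with [h b] = 0, or [ub] or [ab] crosses [vw]. In the crossing
   cases [b] is to the right of [u] by the choice of [u]. If [ub] crosses, [h b <= h a] by the
   choice of [a]; if [ab] crosses, [b] is on the side of [u], where [h] is negative. *)
have side x y : crs x y u a -> (x = v /\ y = w) \/ (x = w /\ y = v) ->
    exists b, [/\ 0 < dt u a b * dt u a x, E u b, E a b, empty_triangle u a b &
      (pt u).1 < (pt b).1 /\ h b <= h a].
  move=> cxy xy; have [xu xa yu ya _] := crs_neq cxy.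
  have [|b [s Eub Eab emp]] := @triangle_beside u a x Eua.
    by apply: gp; rewrite // eq_sym.
  exists b; split=> //.
  have [exb|nxb] := eqVneq x b.
    rewrite -exb; case: xy => -[-> _]; rewrite /h ?detxyx ?detxyy mulr0; split=> //; exact: ltW.
  have bu : b != u by rewrite eq_sym E_neq.
  have toP k l : crs x y k l -> crs v w k l.
    by case: xy => -[-> ->] //; rewrite crossbCl.
  case/orP: (exit_triangle cxy s nxb emp) => /toP hc.
    split; first by apply: ltX => //; have [] := uleft _ _ Eub hc.
    by rewrite -lerN2; apply: amax; rewrite /P /= Eub.
  split; first by apply: ltX => //; have [] := uleft _ _ Eab hc.
  have /andP[hab _] := hc.
  have : h a * h b < 0.
    rewrite /h mulrACA pmulr_rlt0 // mulrNN -expr2 exprn_even_gt0 //=.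
    by apply/eqP => e; rewrite e mul0r ltxx in cua1.
  by rewrite pmulr_rlt0 // => hb; lra.
have [b [sb Eub Eab emp_b [Xb hb]]] := side v w cua (or_introl (conj erefl erefl)).
have cwv : crs w v u a by rewrite crossbCl.
have [c [sc Euc Eac emp_c [Xc hc]]] := side w v cwv (or_intror (conj erefl erefl)).
exists u, a, b, c; split=> //.
have PQ : dt u a b * dt u a c < 0.
  move: (dt u a b) (dt u a c) (dt u a v) (dt u a w) sb sc cua2 => x y z z' xz yz zz.
  have : 0 < (x * z) * (y * z') by exact: mulr_gt0.
  by rewrite mulrACA mulrC nmulr_rgt0.
have ab : a != b := E_neq Eab.
have ac : a != c := E_neq Eac.
have bc : b != c by apply/eqP => e; rewrite e in PQ; have := sqr_ge0 (dt u a c); rewrite expr2; lra.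
have nabc : dt a b c != 0 by exact: gp.
apply/andP; split=> //.
have -> : dt b c u = dt u b c by rewrite -det_rot.
have -> : dt b c a = dt a b c by rewrite -det_rot.
(* The quadrilateral is convex at [u] because [b] and [c] are to the right of [u], and at [a]
   because neither is farther than [a] from [vw]; the identities turn this into signs of [dt u b c]
   and [dt a b c], the latter being strict by general position. *)
have id1 : ((pt a).1 - (pt u).1) * dt u b c =
    ((pt b).1 - (pt u).1) * dt u a c - ((pt c).1 - (pt u).1) * dt u a b.
  by rewrite /det; ring.
have id2 : (h a - h u) * dt a b c = (h a - h c) * dt u a b - (h a - h b) * dt u a c.
  by rewrite /h /det; ring.
have x0 : 0 < (pt a).1 - (pt u).1 by lra.
have y0 : 0 < (pt b).1 - (pt u).1 by lra.
have z0 : 0 < (pt c).1 - (pt u).1 by lra.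
have h0 : 0 < h a - h u by lra.
have h1 : 0 <= h a - h b by lra.
have h2 : 0 <= h a - h c by lra.
move: (dt u b c) (dt a b c) (dt u a b) (dt u a c) ((pt a).1 - _) ((pt b).1 - _)
  ((pt c).1 - _) (h a - h u) (h a - h b) (h a - h c) id1 id2 x0 y0 z0 h0 h1 h2 nabc PQ.
clear => U A p q x y z h hb hc id1 id2 x0 y0 z0 h0 h1 h2 nA PQ.
have [p0|p0|p0] := ltrgtP p 0; last by rewrite p0 mul0r ltxx in PQ.
  have q0 : 0 < q by rewrite -(nmulr_rlt0 _ p0).
  have U0 : 0 < U.
    rewrite -(pmulr_rgt0 _ x0) id1.
    have := mulr_gt0 y0 q0; have : z * p < 0 by rewrite pmulr_rlt0.
    lra.
  rewrite pmulr_rlt0 // lt_neqAle nA /= -(pmulr_rle0 _ h0) id2.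
  have : hc * p <= 0 by rewrite mulr_ge0_le0 // ltW.
  have := mulr_ge0 h1 (ltW q0); lra.
have q0 : q < 0 by rewrite -(pmulr_rlt0 _ p0).
have U0 : U < 0.
  rewrite -(pmulr_rlt0 _ x0) id1.
  have := mulr_gt0 z0 p0; have : y * q < 0 by rewrite pmulr_rlt0.
  lra.
rewrite nmulr_rlt0 // lt_neqAle eq_sym nA /= -(pmulr_rge0 _ h0) id2.
have : hb * q <= 0 by rewrite mulr_ge0_le0 // ltW.
have := mulr_ge0 h2 (ltW p0); lra.
Qed.

End Triangulation.
End GeneralPosition.

(** * Generic points *)

Section GenericPoints.
Variables (R : realType) (n : nat) (p : 'I_n -> 'rV[R]_2).
Hypothesis gen : generic_points p.

(** A polynomial vanishing at generic points is zero, so its non-vanishing there can be checked at a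
    single rational configuration [M]. *)
Lemma generic_nonzero (q : {mpoly rat[n * 2]}) (M : 'M[rat]_(n, 2)) :
  meval (mxvec M 0) q != 0 ->
  mmap ratr (fun k => mxvec (\matrix_(i < n) p i) 0 k) q != 0.
Proof.
by apply: contraNN => /eqP/gen ->; rewrite meval0.
Qed.

Let coord i j : {mpoly rat[n * 2]} := 'X_(mxvec_index i j).

Lemma generic_coord_eval i j :
  mmap ratr (fun k => mxvec (\matrix_(i < n) p i) 0 k) (coord i j) = p i 0 j.
Proof. by rewrite mmapX mmap1U mxvecE mxE. Qed.

Lemma coord_eval (M : 'M[rat]_(n, 2)) i j : meval (mxvec M 0) (coord i j) = M i j.
Proof. by rewrite mevalXU mxvecE. Qed.

Lemma generic_abscissa i j : i != j -> p i 0 0 != p j 0 0.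
Proof.
move=> ij; rewrite -subr_eq0 -!generic_coord_eval -rmorphB.
apply: (@generic_nonzero _ (\matrix_(k, l) (k == i)%:R)).
by rewrite mevalB !coord_eval !mxE eqxx (eq_sym j) (negPf ij) subr0 oner_eq0.
Qed.

Lemma generic_det i j k : i != j -> i != k -> j != k ->
  det (p i 0 0, p i 0 1) (p j 0 0, p j 0 1) (p k 0 0, p k 0 1) != 0.
Proof.
move=> ij ik jk; rewrite /det /= -!generic_coord_eval -!rmorphB -!rmorphM -rmorphB.
(* The test configuration has p_i = (0, 0), p_j = (1, 0), p_k = (0, 1), with determinant 1. *)
apply: (@generic_nonzero _ (\matrix_(a, b) (a == if b == 0 then j else k)%:R)).
rewrite mevalB !mevalM !mevalB !coord_eval !mxE /= !eqxx (negPf ij) (negPf ik).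
by rewrite (negPf jk) (eq_sym k) (negPf jk) !subr0 mulr1 oner_eq0.
Qed.

End GenericPoints.

(** * Non-crossing frameworks *)

Lemma set2_inj (T : finType) (i j k l : T) : [set i; j] = [set k; l] ->
  (i = k /\ j = l) \/ (i = l /\ j = k).
Proof.
move=> e; have : i \in [set k; l] by rewrite -e !inE eqxx.
have : j \in [set k; l] by rewrite -e !inE eqxx orbT.
have : k \in [set i; j] by rewrite e !inE eqxx.
have : l \in [set i; j] by rewrite e !inE eqxx orbT.
rewrite !inE => /orP[]/eqP h1 /orP[]/eqP h2 /orP[]/eqP h3 /orP[]/eqP h4; subst; auto.
Qed.

Lemma disjoint_set2 (T : finType) (i j k l : T) :
  [disjoint [set i; j] & [set k; l]] = [&& i != k, i != l, j != k & j != l].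
Proof.
rewrite -setI_eq0 setIUl setU_eq0 !setI_eq0 !disjoints1 !inE !negb_or.
by rewrite -andbA.
Qed.

Section Frameworks.
Variables (R : realType) (n : nat) (p : 'I_n -> 'rV[R]_2).
Hypothesis gen : generic_points p.
Implicit Types (T E F L : {set {set 'I_n}}) (e f : {set 'I_n}).

Let pt i : R * R := (p i 0 0, p i 0 1).
Let gp i j k : i != j -> i != k -> j != k -> det (pt i) (pt j) (pt k) != 0.
Proof. exact: generic_det. Qed.
Let Xinj i j : i != j -> (pt i).1 != (pt j).1.
Proof. exact: generic_abscissa. Qed.

Local Notation crs i j k l := (crossb (pt i) (pt j) (pt k) (pt l)).

Lemma on_segmentP (i j : 'I_n) (x : 'rV[R]_2) :
  on_segment (p i) (p j) x <-> onseg (pt i) (pt j) (x 0 0, x 0 1).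
Proof.
split=> -[t t01].
  by move=> ->; exists t => //; rewrite /lerp !mxE /=; congr pair; ring.
case=> e0 e1; exists t => //; apply/rowP => k; rewrite !mxE.
have [->|->] : k = 0 \/ k = 1.
  by case: k => -[|[|//]] h; [left|right]; exact: val_inj.
- by rewrite e0 /=; ring.
- by rewrite e1 /=; ring.
Qed.

(** Edges are unordered, hence the quantification over names of endpoints; the naming does not
    matter because [crossb] is symmetric. *)
Definition edges_cross e f : bool :=
  [exists i, exists j, exists k, exists l,
    [&& e == [set i; j], f == [set k; l] & crs i j k l]].

Lemma edges_crossE i j k l : edges_cross [set i; j] [set k; l] = crs i j k l.
Proof.
apply/idP/idP => [|c]; last first.
  by apply/existsP; exists i; apply/existsP; exists j; apply/existsP; exists k;
     apply/existsP; exists l; rewrite !eqxx.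
move=> /existsP[i' /existsP[j' /existsP[k' /existsP[l' /and3P[]]]]].
move=> /eqP/set2_inj h1 /eqP/set2_inj h2 c.
by case: h1 => -[-> ->]; case: h2 => -[-> ->] //; rewrite 1?crossbCl // crossbCr // crossbCl.
Qed.

Lemma edges_cross_disjoint e f : edges_cross e f -> [disjoint e & f].
Proof.
move=> /existsP[i /existsP[j /existsP[k /existsP[l /and3P[/eqP-> /eqP->]]]]].
move=> /crs_neq[ik il jk jl _].
by rewrite disjoint_set2 ik il jk jl.
Qed.

(** A boolean form of non-crossing, as [maxset] requires. In general position non-adjacent edges can
    only meet in a proper crossing, so the two notions agree. *)
Definition planar T : bool :=
  (T \subset Kn n) && [forall e in T, forall f in T, ~~ edges_cross e f].

Lemma planar_nc T i j k l : planar T -> [set i; j] \in T -> [set k; l] \in T ->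
  ~~ crs i j k l.
Proof.
move=> /andP[_ /forall_inP h] e f; have /forall_inP h2 := h _ e.
by rewrite -edges_crossE; exact: h2.
Qed.

Lemma Kn_edge i j : ([set i; j] \in Kn n) = (i != j).
Proof. by rewrite inE cards2; case: (i != j). Qed.

Lemma planarP T : T \subset Kn n -> non_crossing p T <-> planar T.
Proof.
move=> sub; split=> [nc|pl].
  rewrite /planar sub; apply/forall_inP => e eT; apply/forall_inP => f fT.
  apply/negP => c; have := edges_cross_disjoint c; move: c.
  move=> /existsP[i /existsP[j /existsP[k /existsP[l /and3P[/eqP ee /eqP ef c]]]]].
  rewrite ee in eT *; rewrite ef in fT * => dis; apply: (nc i j k l) => //.
  have [M [[t t01 eM] M2]] := crossb_meets c.
  exists ((1 - t) *: p i + t *: p j); split; first by exists t.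
  apply/on_segmentP; rewrite !mxE.
  have -> // : ((1 - t) * p i 0 0 + t * p j 0 0, (1 - t) * p i 0 1 + t * p j 0 1) = M.
  by rewrite eM /lerp /=; congr pair; ring.
move=> i j k l ij kl dis [x [/on_segmentP h1 /on_segmentP h2]].
have nij : i != j by rewrite -Kn_edge (subsetP sub).
have nkl : k != l by rewrite -Kn_edge (subsetP sub).
move: dis; rewrite disjoint_set2 => /and4P[ik il jk jl].
move/negP: (planar_nc pl ij kl); apply; apply: meets_crs => //.
by exists (x 0 0, x 0 1).
Qed.

Lemma planarS T T' : T \subset T' -> planar T' -> planar T.
Proof.
move=> sub /andP[sK /forall_inP h]; apply/andP; split; first exact: subset_trans sK.
apply/forall_inP => e eT; apply/forall_inP => f fT.
by have /forall_inP := h e (subsetP sub e eT); apply; exact: (subsetP sub).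
Qed.

Lemma planarU1 T e : planar T -> e \in Kn n ->
  (forall f, f \in T -> ~~ edges_cross e f) -> planar (e |: T).
Proof.
move=> /andP[sub /forall_inP h] eK ne; apply/andP; split.
  by rewrite subUset sub1set eK.
have sym f g : edges_cross f g -> edges_cross g f.
  move=> /existsP[i /existsP[j /existsP[k /existsP[l /and3P[/eqP-> /eqP-> c]]]]].
  by rewrite edges_crossE crossb_sym.
apply/forall_inP => f; rewrite !inE => fT; apply/forall_inP => g; rewrite !inE => gT.
case/predU1P: fT gT => [->|fT] /predU1P[->|gT].
- apply/negP => /edges_cross_disjoint; rewrite -setI_eq0 setIid => /eqP e0.
  by move: eK; rewrite inE e0 cards0.
- exact: ne.
- by apply/negP => /sym; apply/negP; exact: ne.
- by have /forall_inP := h f fT; apply.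
Qed.

Lemma maxplanar_cross T i j : maxset planar T -> i != j -> [set i; j] \notin T ->
  exists k l, [set k; l] \in T /\ crs i j k l.
Proof.
move=> /maxsetP[pl mx] ij nT.
have [/exists_inP[f fT c]|/exists_inPn h] := boolP [exists f in T, edges_cross [set i; j] f].
  have [sub _] := andP pl; have : f \in Kn n := subsetP sub f fT.
  rewrite inE => /cards2P[k [l [kl ef]]]; exists k, l; rewrite -ef; split=> //.
  by rewrite -edges_crossE -ef.
have pl' : planar ([set i; j] |: T) by apply: planarU1 => //; rewrite Kn_edge.
by move: nT; rewrite -(mx _ pl' (subsetUr _ _)) !inE eqxx.
Qed.

(* If point i is lifted to a height that decreases very fast with its abscissa,
   these are the segments lying somewhere above the lifted graph. *)
Definition covered T : {set 'I_n * 'I_n} :=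
  [set vw : 'I_n * 'I_n | [exists k, exists l, [&& [set k; l] \in T,
    crs vw.1 vw.2 k l, (pt vw.1).1 < (pt k).1 & (pt vw.1).1 < (pt l).1]]].

Lemma coveredP T v w : reflect (exists k l, [/\ [set k; l] \in T, crs v w k l,
    (pt v).1 < (pt k).1 & (pt v).1 < (pt l).1]) ((v, w) \in covered T).
Proof.
rewrite inE; apply: (iffP idP) => [/existsP[k /existsP[l /and4P[]]]|[k [l [*]]]].
  by exists k, l.
by apply/existsP; exists k; apply/existsP; exists l; apply/and4P.
Qed.

Lemma card_covered T : (#|covered T| <= n ^ 2)%N.
Proof.
by apply: leq_trans (max_card _) _; rewrite card_prod card_ord.
Qed.

(** One flip in a maximal non-crossing set, followed by an extension to a maximal set [T1]. It
    records what a framework in [T] requires in order to follow, and the growth of the potential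
    [covered]. *)
Definition tri_flip F T T1 := exists u a b c,
  [/\ [set u; a] \in T, [set u; a] \notin F, maxset planar T1,
    [/\ T :\ [set u; a] \subset T1, u != b, a != b, u != c & a != c] &
    [/\ b != c,
      {subset [:: [set u; b]; [set a; b]; [set u; c]; [set a; c]; [set b; c]] <= T1} &
      (#|covered T| < #|covered T1|)%N]].

Lemma exists_tri_flip F T T' v w : maxset planar T -> planar T' -> F \subset T' ->
    [set v; w] \in T' -> [set v; w] \notin T ->
    (forall k l, [set k; l] \in T -> crs v w k l ->
      ((pt k).1 < (pt v).1 /\ (pt k).1 < (pt w).1) \/
      ((pt l).1 < (pt v).1 /\ (pt l).1 < (pt w).1)) ->
  exists T1, tri_flip F T T1.
Proof.
move=> mT pT' FT' vwT' vwT left_of; have /maxsetP[pT _] := mT.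
have [subT _] := andP pT; have [subT' _] := andP pT'.
have vw : v != w by rewrite -Kn_edge (subsetP subT').
pose E i j := [set i; j] \in T.
have Esym : symmetric E by move=> i j; rewrite /E setUC.
have Eirr : irreflexive E.
  move=> i; apply/negP => /(subsetP subT); by rewrite Kn_edge eqxx.
have nc i j k l : E i j -> E k l -> ~~ crs i j k l by exact: planar_nc.
have mx i j : i != j -> ~~ E i j -> exists k l, E k l /\ crs i j k l.
  exact: maxplanar_cross.
have [u [a [b [c [Eua cvw cr [Eub Eab Euc Eac] [Xa Xb Xc emp_b emp_c]]]]]] :=
  flippable_edge gp Esym Eirr nc mx Xinj vw vwT left_of.
have [ub uc ab ac /andP[ua bc]] := crs_neq cr.
set e := [set u; a].
have pT1 : planar ([set b; c] |: (T :\ e)).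
  apply: planarU1; first exact: planarS (subsetDl _ _) pT.
    by rewrite Kn_edge.
  move=> f; rewrite !inE => /andP[fe fT]; apply/negP.
  have : f \in Kn n := subsetP subT f fT.
  rewrite inE => /cards2P[k [l [kl ef]]]; rewrite ef edges_crossE => hc.
  rewrite ef in fT fe.
  have := flip_noncrossing gp Esym nc cr Eub Eab Euc Eac emp_b emp_c fT hc.
  by case=> -[ek el]; move: fe; rewrite ek el /e ?eqxx // setUC eqxx.
have [T1 mT1 sub1] := maxset_exists pT1.
exists T1, u, a, b, c.
have keep f : f \in T -> f != e -> f \in T1.
  by move=> fT fe; apply: (subsetP sub1); rewrite !inE fe fT orbT.
have bcT1 : [set b; c] \in T1 by apply: (subsetP sub1); rewrite !inE eqxx.
have ne x y : x != u -> x != a -> [set y; x] != e.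
  move=> xu xa; apply/eqP => h; have : x \in e by rewrite -h !inE eqxx orbT.
  by rewrite !inE (negPf xu) (negPf xa).
have bu : b != u by rewrite eq_sym.
have ba : b != a by rewrite eq_sym.
have cu : c != u by rewrite eq_sym.
have ca : c != a by rewrite eq_sym.
have T1ub : [set u; b] \in T1 by apply: keep => //; exact: ne.
have T1ab : [set a; b] \in T1 by apply: keep => //; exact: ne.
have T1uc : [set u; c] \in T1 by apply: keep => //; exact: ne.
have T1ac : [set a; c] \in T1 by apply: keep => //; exact: ne.
split=> //.
(* An edge of [F] belongs to [T'], so it cannot cross [vw], as [ua] does. *)
- apply/negP => eF; move/negP: (planar_nc pT' vwT' (subsetP FT' _ eF)); exact.
- split=> //; apply/subsetP => f; rewrite !inE => /andP[fe fT]; exact: keep.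
split=> //.
  by move=> f; rewrite !inE => /or4P[|||/orP[]] /eqP->.
apply: proper_card; apply/properP; split.
  apply/subsetP => -[x y] /coveredP[k [l [klT ckl Xk Xl]]]; apply/coveredP.
  have [ekl|nkl] := eqVneq [set k; l] e; last by exists k, l; split=> //; exact: keep.
  (* A segment [xy] crossing [ua] also crosses one of the four sides, and these lie to the right of
     [x] because [b] and [c] are to the right of [u]. *)
  have [cxy Xu] : crs x y u a /\ (pt x).1 < (pt u).1.
    by case: (set2_inj ekl) => -[<- <-] //; rewrite crossbCr.
  have xb : x != b by apply/eqP => h; rewrite h in Xu; lra.
  have xc : x != c by apply/eqP => h; rewrite h in Xu; lra.
  have Xxa : (pt x).1 < (pt a).1 by exact: lt_trans Xa.
  have Xxb : (pt x).1 < (pt b).1 by exact: lt_trans Xb.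
  have Xxc : (pt x).1 < (pt c).1 by exact: lt_trans Xc.
  have := flip_crossing gp cr emp_b emp_c cxy xb xc.
  by case/or4P=> hc; [exists u, b | exists a, b | exists u, c | exists a, c].
(* The new pair: [bc] covers it, whereas no edge of [T] crosses the edge [ua] of [T]. *)
exists (u, a); first by apply/coveredP; exists b, c.
apply/negP => /coveredP[k [l [klT ckl _ _]]].
by move/negP: (planar_nc pT Eua klT); exact.
Qed.

Lemma tri_flip_exists F T T' : maxset planar T -> maxset planar T' ->
    F \subset T -> F \subset T' -> T <> T' ->
  (exists T1, tri_flip F T T1) \/ (exists T1, tri_flip F T' T1).
Proof.
move=> mT mT' FT FT' neq.
(* Edges on which [T] and [T'] differ, written with the left endpoint first. *)
pose P (x : 'I_n * 'I_n) := (((pt x.1).1 < (pt x.2).1)) &&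
  (([set x.1; x.2] \in T) != ([set x.1; x.2] \in T')).
have diffP i j : ([set i; j] \in T) != ([set i; j] \in T') -> i != j ->
    P (i, j) \/ P (j, i).
  move=> d ij; have := Xinj ij; rewrite neq_lt /P /= => /orP[h|h]; [left|right].
    by rewrite h.
  by rewrite h setUC.
have [sT _] := andP (maxsetp mT); have [sT' _] := andP (maxsetp mT').
have [x0 Px0] : exists x, P x.
  have [/existsP[e de]|h] := boolP [exists e, (e \in T) != (e \in T')]; last first.
    case: neq; apply/setP => e; apply/eqP/negPn/negP => de.
    by move/negP: h; apply; apply/existsP; exists e.
  have : e \in Kn n.
    case: (boolP (e \in T)) (de) => [eT _|_]; first exact: (subsetP sT).
    by case: (boolP (e \in T')) => // eT' _; exact: (subsetP sT').
  rewrite inE => /cards2P[i [j [ij ee]]]; rewrite ee in de.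
  by have [h|h] := diffP i j de ij; [exists (i, j) | exists (j, i)].
have [[v w] /= /andP[/= Xvw dvw] vmax] := ex_argmin (fun x : 'I_n * 'I_n => - (pt x.1).1) Px0.
have key A B : maxset planar A -> maxset planar B -> F \subset B ->
    [set v; w] \in B -> [set v; w] \notin A ->
    (forall i j, [set i; j] \in A -> [set i; j] \notin B -> P (i, j) \/ P (j, i)) ->
    exists T1, tri_flip F A T1.
  move=> mA mB FB vwB vwA hP; have pB := maxsetp mB; have [sB _] := andP pB.
  apply: (exists_tri_flip mA pB FB vwB vwA) => k l klA ckl.
  (* Crossing [vw], the edge [kl] cannot be in [B], so the two sets differ on it; its left end is
     not to the right of [v] by the choice of [v], and it is not [v]. *)
  have klB : [set k; l] \notin B.
    by apply/negP => klB; move/negP: (planar_nc pB vwB klB); exact.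
  have [vk vl _ _ _] := crs_neq ckl.
  case: (hP k l klA klB) => h; [left|right]; have := vmax _ h; rewrite lerN2 => h2.
    have h3 : (pt k).1 < (pt v).1 by rewrite lt_neqAle h2 andbT; apply: Xinj; rewrite eq_sym.
    by split=> //; exact: lt_trans Xvw.
  have h3 : (pt l).1 < (pt v).1 by rewrite lt_neqAle h2 andbT; apply: Xinj; rewrite eq_sym.
  by split=> //; exact: lt_trans Xvw.
have [vwT|vwT] := boolP ([set v; w] \in T).
  right; have vwT' : [set v; w] \notin T' by move: dvw; rewrite vwT; case: (_ \in T').
  apply: (key T' T) => // i j h1 h2; apply: diffP; first by rewrite h1 (negPf h2).
  by rewrite -Kn_edge (subsetP sT').
left; have vwT' : [set v; w] \in T' by move: dvw; rewrite (negPf vwT); case: (_ \in T').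
apply: (key T T') => // i j h1 h2; apply: diffP; first by rewrite h1 (negPf h2).
by rewrite -Kn_edge (subsetP sT).
Qed.

(** * Sequences of flips between frameworks *)

Definition flip_connected F (k : nat) L L' := exists s : seq {set {set 'I_n}},
  [/\ path (@edge_flip n) L s, last L s = L',
      forall E, E \in s -> constrained_nc_laman p F E & (size s <= k)%N].

Lemma flip_connected_cons F k L L1 L' : edge_flip L L1 ->
    constrained_nc_laman p F L1 -> flip_connected F k L1 L' ->
  flip_connected F k.+1 L L'.
Proof.
move=> fl g1 [s [ps ls gs ss]]; exists (L1 :: s); split=> //=.
  by rewrite fl.
by move=> E; rewrite inE => /predU1P[->|/gs].
Qed.

Lemma flip_connected_rcons F k L L1 L' : edge_flip L1 L' ->
    constrained_nc_laman p F L' -> flip_connected F k L L1 ->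
  flip_connected F k.+1 L L'.
Proof.
move=> fl g1 [s [ps ls gs ss]]; exists (rcons s L'); split=> //=.
- by rewrite rcons_path ps ls.
- by rewrite last_rcons.
- by move=> E; rewrite mem_rcons inE => /predU1P[->|/gs].
- by rewrite size_rcons.
Qed.

Lemma flip_connected_le F k k' L L' : (k <= k')%N ->
  flip_connected F k L L' -> flip_connected F k' L L'.
Proof. by move=> kk [s [ps ls gs ss]]; exists s; split=> //; exact: leq_trans kk. Qed.

Lemma edge_flip_exchange L e g : e \in L -> g \notin L -> edge_flip L (g |: (L :\ e)).
Proof.
move=> eL gL; apply/exists_inP; exists e => //; apply/exists_inP; exists g => //.
by rewrite inE.
Qed.

Lemma edge_flip_sym L L' : edge_flip L L' -> edge_flip L' L.
Proof.
move=> /exists_inP[e eL /exists_inP[g]]; rewrite inE => gL /eqP->.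
apply/exists_inP; exists g; first by rewrite !inE eqxx.
have ge : g != e by apply/eqP => h; rewrite h eL in gL.
apply/exists_inP; exists e; first by rewrite !inE eqxx eq_sym (negPf ge).
rewrite setU1K; last by rewrite !inE (negPf gL) andbF.
by rewrite setD1K.
Qed.

Lemma constrained_planar F T L : planar T -> laman_graph L -> L \subset T ->
  F \subset L -> constrained_nc_laman p F L.
Proof.
move=> pT lL LT FL; split=> //; have [sub _ _] := lL.
by apply/(planarP sub); exact: planarS LT pT.
Qed.

(** Exchange edges of [L] outside [L'] for edges of [L']. Everything stays in the planar set [T],
    hence non-crossing, and a removed edge is outside [L'], hence outside [F]. *)
Lemma flip_connected_same F T L L' : planar T -> laman_graph L -> laman_graph L' ->
    L \subset T -> L' \subset T -> F \subset L -> F \subset L' ->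
  flip_connected F #|L :\: L'| L L'.
Proof.
move=> pT + lL' + L'T + FL'; move: {2}#|_| (leqnn #|L :\: L'|) => m.
elim: m L => [|m IH] L hm lL LT FL.
  have LL' : L \subset L' by rewrite -setD_eq0 -cards_eq0 -leqn0.
  have -> : L = L'.
    apply/eqP; rewrite eqEcard LL' /=; have [_ c1 _] := lL; have [_ c2 _] := lL'.
    by move: c1 c2; clear; clia.
  by exists [::].
have [/eqP h0|] := boolP (#|L :\: L'| == 0%N).
  by apply: IH => //; rewrite h0.
rewrite cards_eq0 => /set0Pn[e]; rewrite inE => /andP[eL' eL].
have [g gL' [ng lg]] := laman_exchange lL lL' eL.
have ge : g != e by apply/eqP => h; rewrite h (negPf eL') in gL'.
have gL : g \notin L by move: ng; rewrite !inE ge.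
set L1 := g |: (L :\ e) in lg.
have L1T : L1 \subset T.
  by rewrite subUset sub1set (subsetP L'T) // (subset_trans (subsetDl _ _)).
have FL1 : F \subset L1.
  apply/subsetP => f fF; rewrite !inE (subsetP FL) // andbT.
  have [h|_] := eqVneq f e; last by rewrite orbT.
  by rewrite -h (subsetP FL') in eL'.
have cL1 : (#|L1 :\: L'|.+1 = #|L :\: L'|)%N.
  rewrite [RHS](cardsD1 e) inE eL eL' add1n; congr _.+1; apply: eq_card => f.
  rewrite !inE; have [->|fg] := eqVneq f g; first by rewrite gL' andbF.
  by rewrite /= andbCA.
rewrite -cL1; apply: (flip_connected_cons (edge_flip_exchange eL gL)).
  exact: constrained_planar pT lg L1T FL1.
by apply: IH => //; rewrite -ltnS cL1.
Qed.

Lemma laman_follow_flip F T T1 L : tri_flip F T T1 -> laman_graph L ->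
    L \subset T -> F \subset L ->
  exists L1, [/\ laman_graph L1, L1 \subset T1, F \subset L1 &
    L1 = L \/ edge_flip L L1].
Proof.
move=> [u [a [b [c [eT eF mT1 [sub ub ab uc ac] [bc five _]]]]]] lL LT FL.
have [eL|eL] := boolP ([set u; a] \in L); last first.
  exists L; split=> //; last by left.
  apply: subset_trans sub; apply/subsetP => f fL; rewrite !inE (subsetP LT) // andbT.
  by apply/eqP => h; rewrite -h fL in eL.
have [sub1 _] := andP (maxsetp mT1).
have [g gT1 [ng lg]] := laman_flip lL sub1 eL ub ab uc ac bc five.
set e := [set u; a] in eT eF sub eL ng lg *.
exists (g |: (L :\ e)); split=> //.
- rewrite subUset sub1set gT1; apply: subset_trans sub; exact: setSD.
- apply/subsetP => f fF; rewrite !inE (subsetP FL) // andbT.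
  have [h|_] := eqVneq f e; last by rewrite orbT.
  by rewrite -h fF in eF.
(* The exchange may return the removed edge, and then the framework does not move. *)
have [ge|ge] := eqVneq g e; first by left; rewrite ge setD1K.
by right; apply: edge_flip_exchange => //; move: ng; rewrite !inE ge.
Qed.

(** [m] is the remaining budget: [T] and [T'] have at most n^2 covered pairs each, and every flip of
    one of them increases the total and costs at most one flip of a framework. The final 2 n pays
    for exchanges inside a common set, as a framework has fewer than 2 n edges. *)
Lemma flip_connected_planar F m T T' L L' :
    (2 * n ^ 2 <= #|covered T| + #|covered T'| + m)%N ->
    maxset planar T -> maxset planar T' ->
    laman_graph L -> laman_graph L' -> L \subset T -> L' \subset T' ->
    F \subset L -> F \subset L' ->
  flip_connected F (m + 2 * n) L L'.
Proof.
elim/ltn_ind: m T T' L L' => m IH T T' L L' hm mT mT' lL lL' LT L'T' FL FL'.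
have [eTT'|neq] := eqVneq T T'.
  rewrite -eTT' in L'T'; apply: (@flip_connected_le _ #|L :\: L'|).
    have : (#|L :\: L'| <= #|L|)%N by rewrite subset_leq_card // subsetDl.
    by have [_ c1 _] := lL; move: c1; clear; clia.
  exact: (flip_connected_same (maxsetp mT)).
have FT := subset_trans FL LT; have FT' := subset_trans FL' L'T'.
have [[T1 fl]|[T1 fl]] := tri_flip_exists mT mT' FT FT' (elimN eqP neq).
  have [L1 [lL1 L1T1 FL1 h]] := laman_follow_flip fl lL LT FL.
  have [_ [_ [_ [_ [_ _ mT1 _ [_ _ lt]]]]]] := fl.
  have gL1 := constrained_planar (maxsetp mT1) lL1 L1T1 FL1.
  (* [m] is positive because |covered T| is strictly below its bound n^2. *)
  have lem : (m.-1 < m /\ 2 * n ^ 2 <= #|covered T1| + #|covered T'| + m.-1)%N.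
    have := card_covered T1; have := card_covered T'; move: hm lt; clear; clia.
  have := IH m.-1 (proj1 lem) T1 T' L1 L' (proj2 lem) mT1 mT' lL1 lL' L1T1 L'T' FL1 FL'.
  have em : m = m.-1.+1 by move: (proj1 lem); clear; lia.
  case: h => [->|h] c; first by apply: flip_connected_le c; rewrite leq_add2r leq_pred.
  by rewrite em addSn; exact: flip_connected_cons c.
(* Here the target [L'] moves to [L1], so the reversed flip goes at the end of the sequence. *)
have [L1 [lL1 L1T1 FL1 h]] := laman_follow_flip fl lL' L'T' FL'.
have [_ [_ [_ [_ [_ _ mT1 _ [_ _ lt]]]]]] := fl.
have gL' := constrained_planar (maxsetp mT') lL' L'T' FL'.
have lem : (m.-1 < m /\ 2 * n ^ 2 <= #|covered T| + #|covered T1| + m.-1)%N.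
  have := card_covered T; have := card_covered T1; move: hm lt; clear; clia.
have := IH m.-1 (proj1 lem) T T1 L L1 (proj2 lem) mT mT1 lL lL1 LT L1T1 FL FL1.
have em : m = m.-1.+1 by move: (proj1 lem); clear; lia.
case: h => [->|/edge_flip_sym h] c.
  by apply: flip_connected_le c; rewrite leq_add2r leq_pred.
by rewrite em addSn; exact: flip_connected_rcons c.
Qed.

Lemma constrained_flip_connected F L L' : constrained_nc_laman p F L ->
  constrained_nc_laman p F L' -> flip_connected F (4 * n ^ 2) L L'.
Proof.
move=> [lL ncL FL] [lL' ncL' FL'].
have [sub _ _] := lL; have [sub' _ _] := lL'.
have [T mT LT] := maxset_exists (iffLR (planarP sub) ncL).
have [T' mT' L'T'] := maxset_exists (iffLR (planarP sub') ncL').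
(* The budget 2 n^2 suffices whatever the initial potentials are, and 2 n <= 2 n^2. *)
apply: (@flip_connected_le _ (2 * n ^ 2 + 2 * n)); first by nia.
by apply: (@flip_connected_planar _ _ T T') => //; rewrite leq_addl.
Qed.

End Frameworks.

Theorem theorem2 (R : realType) :
  exists C : nat, forall (n : nat) (p : 'I_n -> 'rV[R]_2) (F : {set {set 'I_n}}),
    generic_points p -> non_crossing p F -> laman_independent F ->
    forall E1 E2 : {set {set 'I_n}},
      constrained_nc_laman p F E1 -> constrained_nc_laman p F E2 ->
      exists s : seq {set {set 'I_n}},
        [/\ path (@edge_flip n) E1 s, last E1 s = E2,
            forall E, E \in s -> constrained_nc_laman p F E
          & (size s <= C * n ^ 2)%N].
Proof.
exists 4 => n p F gen _ _ E1 E2 h1 h2.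
exact: (constrained_flip_connected gen h1 h2).
Qed.
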